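(* Let $k$ be a number field and $f\in k[x]$ as below. For every $P\in J(k)$ with Mumford triple $(U,V,R)$, $U=x^m+u_1x^{m-1}+\dots+u_m$, one has $$h(1:u_1:\dots:u_m)\le h(\kappa(P)),$$ where on the right $\kappa(P)\in\mathbb{P}^{2^g-1}(k)$ is written in the coordinates $x_I$.
   Context: Heights: for a number field $k$, $M_k$ is the set of absolute values on $k$ extending the standard $p$-adic or archimedean absolute values of $\mathbb{Q}$, $d_v=[k_v:\mathbb{Q}_v]$, and for $x=[x_0:\dots:x_n]\in\mathbb{P}^n(k)$, $h(x)=[k:\mathbb{Q}]^{-1}\sum_{v\in M_k}d_v\log\max_i|x_i|_v$. Let $g\ge1$ and $f(x)=x^{2g+1}+c_1x^{2g}+\dots+c_{2g+1}\in k[x]$ of nonzero discriminant; $C$ the smooth projective curve with affine model $y^2=f(x)$, $P_\infty$ its point at infinity, $J$ its Jacobian. Mumford representation: each $P\in J(k)$ corresponds to a unique triple $(U,V,R)$ in $k[x]$ with $U$ monic of degree $m\in\{0,\dots,g\}$, $V$ monic of degree $2g+1-m$, $\deg R\le m-1$, $f-R^2=UV$; $P$ is the class of $E-mP_\infty$, $E$ cut out by $U(x)=0$, $y=R(x)$. Quadratic space $V_f=k[x]/(f)$, $\psi(a,b)=\tau(ab)$ with $\tau(\sum_{i\le 2g}a_ix^i)=a_{2g}$; basis $p_i=x^i$ ($0\le i\le g$), $p_{g+i}=x^{g+i}+c_1x^{g+i-1}+\dots+c_{2i-1}x^{g-i+1}+\tfrac12c_{2i}x^{g-i}$ ($1\le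 i\le g$), so $\psi(p_i,p_j)=\delta_{i+j,2g}$. $F=\langle p_0,..,p_{g-1}\rangle$, $E=\langle p_{g+1},..,p_{2g}\rangle$; spin representation $S=\bigwedge^*E$ of the Clifford algebra $C(V_f)$ (tensor algebra modulo $v\otimes v-\psi(v,v)$) with: $e\in E$ acting by $e\wedge-$, $f'\in F$ by $w_1\wedge\cdots\wedge w_r\mapsto\sum_i(-1)^{i-1}2\psi(f',w_i)w_1\wedge\cdots\widehat{w_i}\cdots\wedge w_r$, $p_g$ by $(-1)^r$ on $\bigwedge^rE$. Basis $p_I=p_{i_r}\wedge\cdots\wedge p_{i_1}$ for $I=\{i_1<\dots<i_r\}\subseteq\{g+1,\dots,2g\}$, with dual coordinates $x_I$. Pure spinor of a $g$-dimensional isotropic $L$: nonzero $\omega_L\in S$ with $\{v:v\omega_L=0\}=L$ (unique up to scalar). For $P$ with Mumford triple $(U,V,R)$ of degree $m$ write, for $0\le j\le m-1$, $x^jV=t_jU+a_j$, $-2x^jR=s_jU+b_j$ with $\deg a_j,\deg b_j\le m-1$; $\Psi(P)\subseteq V_f$ is the span of the images of $x^iU$ ($0\le i\le g-m-1$) and $-2x^jV+a_j+s_jR$ ($0\le j\le m-1$), a $g$-dimensional isotropic subspace; and $\kappa(P)=[\omega_{\Psi(P)}]\in\mathbb{P}(S)\cong\mathbb{P}^{2^g-1}$. *)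

(* Defs.v *)
From HB Require Import structures.
From mathcomp Require Import all_boot all_order all_algebra all_field.
From mathcomp Require Import all_classical all_reals exp.

Set Implicit Arguments.
Unset Strict Implicit.
Unset Printing Implicit Defensive.

Import Order.TTheory GRing.Theory Num.Theory.
Local Open Scope ring_scope.

Section Heights.
Variables (R : realType) (k : fieldExtType rat).

Definition is_absval (v : k -> R) : Prop :=
  [/\ v 0 = 0, (forall x, x != 0 -> 0 < v x),
      (forall x y, v (x * y) = v x * v y) &
      (forall x y, v (x + y) <= v x + v y)].

Definition padic_abs (p : nat) (q : rat) : R :=
  if q == 0 then 0
  else (p%:R : R) ^ ((logn p `|denq q|)%:Z - (logn p `|numq q|)%:Z).

Definition places : set (k -> R) :=
  [set v | is_absval v /\
     ((forall q : rat, v (ratr q) = `|ratr q : R|) \/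
      (exists p, prime p /\ forall q : rat, v (ratr q) = padic_abs p q))].

(* a_0..a_{n-1} in k are linearly independent over the completion Q_v
   (equivalently: the induced Q-linear map is bounded below w.r.t. v) *)
Definition indep_over_completion (v : k -> R) (n : nat) : Prop :=
  exists (a : 'I_n -> k) (c : R), 0 < c /\
    forall q : 'I_n -> rat,
      c * \big[Num.max/0]_(i < n) v (ratr (q i))
        <= v (\sum_(i < n) ratr (q i) * a i).

(* d_v = [k_v : Q_v] = dimension of the completion k_v over Q_v
   = maximal number of elements of k independent over Q_v *)
Definition local_degree (v : k -> R) : nat :=
  \max_(n < (\dim {:k}).+1 | `[< indep_over_completion v n >]) n.

Definition height (s : seq k) : R :=
  (\dim {:k})%:R^-1 *
    \sum_(v \in places) (local_degree v)%:R *
       @ln R (\big[Num.max/0]_(y <- s) v y).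

End Heights.

Notation spinor_t k g := {ffun {set 'I_g} -> k}.

Section Spin.
Variables (k : fieldExtType rat) (g : nat) (f : {poly k}).

Definition discriminant : k :=
  (-1) ^+ (((size f).-1 * (size f).-2) %/ 2) * resultant f f^`().

Definition tau (a : {poly k}) : k := (a %% f)`_(2 * g).
Definition psi (a b : {poly k}) : k := tau (a * b).

Definition pE (t : nat) : {poly k} :=
  'X^(g + t) + \sum_(1 <= l < 2 * t) f`_(2 * g + 1 - l) *: 'X^(g + t - l)
  + (2^-1 * f`_(2 * g + 1 - 2 * t)) *: 'X^(g - t).

(* S = /\^* E, with E-basis p_{g+1+j} for j : 'I_g; an element of S is
   given by its coordinates x_I, I : {set 'I_g} (dual to p_I). *)
Local Notation spinor := (spinor_t k g).

Definition sgn_above (I : {set 'I_g}) (j : 'I_g) : k :=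
  (-1) ^+ #|[set i in I | (j < i)%N]|.

Definition wedgeE (j : 'I_g) (w : spinor) : spinor :=
  [ffun J : {set 'I_g} => if j \in J then sgn_above (J :\ j) j * w (J :\ j) else 0].

(* action of p_{g-1-j} in F (the partner of p_{g+1+j}): 2 * contraction *)
Definition contrF (j : 'I_g) (w : spinor) : spinor :=
  [ffun J : {set 'I_g} => if j \in J then 0 else 2 * sgn_above J j * w (j |: J)].

(* action of p_g : (-1)^r on /\^r E *)
Definition parity (w : spinor) : spinor :=
  [ffun J : {set 'I_g} => (-1) ^+ #|J| * w J].

(* Clifford action of v in V_f on S, by linearity in the basis p_i:
   the coordinate of v on p_i is psi(v, p_{2g-i}). *)
Definition cliff_act (v : {poly k}) (w : spinor) : spinor :=
  [ffun J : {set 'I_g} =>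
     \sum_(j < g) psi v 'X^(g - 1 - j) * wedgeE j w J
   + \sum_(j < g) psi v (pE j.+1) * contrF j w J
   + psi v 'X^g * parity w J].

Definition in_span_mod (ws : seq {poly k}) (v : {poly k}) : Prop :=
  exists c : nat -> k, f %| v - \sum_(i < size ws) c i *: ws`_i.

Definition pure_spinor (ws : seq {poly k}) (w : spinor) : Prop :=
  w != 0 /\ forall v : {poly k}, cliff_act v w = 0 <-> in_span_mod ws v.

Definition mumford_triple (U V R : {poly k}) : Prop :=
  [/\ U \is monic, V \is monic, ((size U).-1 <= g)%N,
      size V = (2 * g + 2 - (size U).-1)%N &
      (size R <= (size U).-1)%N /\ f - R ^+ 2 = U * V].

Definition Psi_gens (U V R : {poly k}) : seq {poly k} :=
  let m := (size U).-1 in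
  [seq 'X^i * U | i <- iota 0 (g - m)] ++
  [seq (-2) *: ('X^j * V) + ('X^j * V) %% U + ((-2) *: ('X^j * R)) %/ U * R
     | j <- iota 0 m].

End Spin.

(* Main.v *)
Require Import Defs.
From HB Require Import structures.
From mathcomp Require Import all_boot all_order all_fingroup all_algebra all_field.
From mathcomp Require Import all_classical all_reals exp.
From mathcomp Require Import zify ring lra.

Set Implicit Arguments.
Unset Strict Implicit.
Unset Printing Implicit Defensive.

Import Order.TTheory GRing.Theory Num.Theory.
Local Open Scope ring_scope.

(* Spinor side. Write m = deg U.  The generators X^i U of Psi lie in F and kill w
   by contraction; the other generators q satisfy q / f = -2 X^j / U up to terms
   without residue against 1, ..., X^g, so their pairings with X^s are residues
   modulo U.  Both relations together determine w from its coordinate c on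
   p_{2g-m+1} ^ ... ^ p_{2g}; hence c <> 0, and every c u_i occurs, up to sign,
   among the coordinates of w.

   Arithmetic side. It remains to see that sum_v d_v ln v(c) >= 0, with finite
   support.  Fix an absolute value v0 of Q.  The spectral radius of a norm on
   the Q-algebra k is, by Gelfand's argument, the maximum of the extensions of v0;
   as the trace form is nondegenerate it dominates the coordinates in a basis.
   Bases adapted to the finitely many extensions (weak approximation, local
   degrees) then give v0(N c) <= K prod_v v(c)^{d_v}, and K = 1 follows from
   taking powers of c.  Summing over v0, the product formula for the rational
   number N c gives the claim. *)

(** * Residues modulo f and modulo U *)

(** No completion of [k] is constructed: [local_degree] measures independence over Q_v by
    inequalities between elements of [k], so the decomposition of k tensor Q_v is imitated inside
    [k], up to small errors, by weak approximation. For the errors to be small in coordinates, an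
    element must be controlled by its values at the extensions of v0 alone, and equivalence of norms
    over a complete field is not at hand. The spectral radius fills this gap: it is attained by an
    extension and it bounds traces. Real scalars are missing too. Normalising an element uses a
    rational [pi] with v0(pi) > 1 and costs a bounded factor; this is harmless, since the final norm
    inequality is freed of its constant by powers. The local norm bound is one-sided because scaling
    the coordinates by c enters the comparison of heights only through a lower bound for the sum of
    d_v ln v(c). Finite support matters because the sum over [places] is 0 by convention when its
    support is infinite. *)

Lemma coef_monicM_top (K : fieldType) (p q : {poly K}) (m d : nat) :
  p \is monic -> size p = m.+1 -> (size q <= d.+1)%N -> (p * q)`_(m + d) = q`_d.
Proof.
move=> mp sp; rewrite leq_eqVlt ltnS => /predU1P[sq|sq].
  have q0 : q != 0 by rewrite -size_poly_gt0 sq.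
  have := lead_coef_monicM q mp; rewrite /lead_coef size_monicM // sp sq.
  by rewrite addSn addnS.
rewrite !nth_default //.
have [->|q0] := eqVneq q 0; first by rewrite mulr0 size_poly0.
by rewrite size_monicM // sp addSn /= leq_add2l.
Qed.

(* The coefficient of [X^d] modulo [f] is the residue at infinity of [h / f];
   the hypothesis reads [q / f = A / U] up to terms without residue. *)
Lemma coef_modp_residue (K : fieldType) (f U q A r : {poly K}) (m d s : nat) :
  f \is monic -> size f = d.+2 -> U \is monic -> size U = m.+2 ->
  U * q = A * f + r -> (size ('X^s * r)%R <= m.+1 + d)%N ->
  ((q * 'X^s) %% f)`_d = ((A * 'X^s) %% U)`_m.
Proof.
move=> mf sf mU sU eqU sr.
pose Q := (A * 'X^s) %/ U; pose rho := (A * 'X^s) %% U.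
have eA : A * 'X^s = Q * U + rho by exact: divp_eq.
have srho : (size rho <= m.+1)%N by rewrite -ltnS -sU ltn_modp monic_neq0.
(* The same quotient [Q] serves on both sides: [U * D] has degree at most [m + d + 1], so [D] is the
   remainder of [q * 'X^s] modulo [f]. Comparing coefficients in that degree gives the claim, as
   ['X^s * r] stays below it. *)
pose D := q * 'X^s - Q * f.
have eD : U * D = f * rho + 'X^s * r.
  have -> : U * D = (U * q) * 'X^s - Q * U * f by rewrite /D; ring.
  rewrite eqU; have -> : (A * f + r) * 'X^s = (A * 'X^s) * f + 'X^s * r by ring.
  by rewrite eA; ring.
have sD : (size D <= d.+1)%N.
  have [->|D0] := eqVneq D 0; first by rewrite size_poly0.
  have : (size (U * D)%R <= m.+1 + d.+1)%N.
    rewrite eD (leq_trans (size_polyD _ _)) // geq_max; apply/andP; split.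
      rewrite (leq_trans (size_polyMleq _ _)) // sf.
      by move: (size rho) srho => x; lia.
    by lia.
  rewrite size_monicM // sU; lia.
have -> : (q * 'X^s) %% f = D.
  have -> : q * 'X^s = Q * f + D by rewrite /D; ring.
  by rewrite modp_addl_mul_small // sf ltnS.
rewrite -(@coef_monicM_top _ U D m.+1 d) // eD coefD [X in _ + X]nth_default // addr0.
by rewrite -(@coef_monicM_top _ f rho d.+1 m) // addnC addnS addSn.
Qed.

(** Nondegeneracy of the residue pairing on k[x]/U: a nonzero remainder [C] of [B], multiplied by
    ['X^(m - size C)], carries its leading coefficient to degree [m - 1] without any reduction. *)
Lemma dvdp_residue (K : fieldType) (U B : {poly K}) (m : nat) :
  U \is monic -> size U = m.+1 ->
  (forall i, (i < m)%N -> (('X^i * B) %% U)`_m.-1 = 0) -> U %| B.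
Proof.
move=> mU sU h; rewrite /dvdp; apply/eqP; apply/eqP/negPn/negP => C0.
set C := B %% U in C0.
have sC : (size C <= m)%N by rewrite -ltnS -sU ltn_modp monic_neq0.
have C1 : (0 < size C)%N by rewrite size_poly_gt0.
have := h (m - size C)%N; rewrite -modp_mul -/C modp_small; last first.
  by rewrite mulrC size_mulXn // sU subnK.
have [i1 i2 i3] : [/\ (m.-1 < m - size C)%N = false,
    (m.-1 - (m - size C) = (size C).-1)%N & (m - size C < m)%N].
  by move: (size C) sC C1 => x *; split; lia.
rewrite coefXnM i1 i2 => /(_ i3)/eqP.
by rewrite -[_ == 0]/(lead_coef C == 0) lead_coef_eq0 (negPf C0).
Qed.

(** * The form [psi] on monomials and on the basis elements [pE] *)

Section Tau.
Variables (k : fieldExtType rat) (g : nat) (f : {poly k}).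
Hypotheses (mf : f \is monic) (sf : size f = (2 * g + 2)%N).

Implicit Types a b P : {poly k}.

Lemma tauD a b : tau g f (a + b) = tau g f a + tau g f b.
Proof. by rewrite /tau modpD coefD. Qed.

Lemma tauZ c a : tau g f (c *: a) = c * tau g f a.
Proof. by rewrite /tau modpZl coefZ. Qed.

Lemma tau_sum (I : Type) (r : seq I) (P : pred I) (F : I -> {poly k}) :
  tau g f (\sum_(i <- r | P i) F i) = \sum_(i <- r | P i) tau g f (F i).
Proof.
apply: (big_morph _ tauD); by rewrite /tau mod0p coef0.
Qed.

Lemma tau_small a : (size a <= 2 * g)%N -> tau g f a = 0.
Proof.
move=> sa; rewrite /tau modp_small ?sf; last by rewrite (leq_ltn_trans sa) //; lia.
by rewrite nth_default.
Qed.

Lemma tau_mull a : tau g f (a * f) = 0.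
Proof. by rewrite /tau modp_mull coef0. Qed.

(** Above degree [g - t], [pE g f t] is [f] shifted down by [g + 1 - t]; the halved coefficient sits
    exactly at [g - t], just outside this range. *)
Lemma coef_pE t n : (t <= g)%N -> (0 < t)%N -> (g - t < n)%N ->
  (pE g f t)`_n = f`_(n + g.+1 - t).
Proof.
move=> tg t0 nt; rewrite /pE !coefD coefXn coef_sum coefZ coefXn.
have -> : (n == (g - t)%N) = false by apply/eqP; lia.
rewrite mulr0 addr0.
have [ng|ng|->] := ltngtP n (g + t)%N.
- rewrite add0r (bigD1_seq (g + t - n)%N) ?iota_uniq ?mem_index_iota //=; last by lia.
  rewrite big1_seq ?addr0 => [|l].
    rewrite coefZ coefXn.
    have -> : (n == (g + t - (g + t - n)))%N by apply/eqP; lia.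
    by rewrite mulr1; congr (f`_ _); lia.
  move=> /andP[ln]; rewrite mem_index_iota => hl; rewrite coefZ coefXn.
  have -> : (n == (g + t - l))%N = false by apply/eqP; move/eqP: ln; lia.
  by rewrite mulr0.
- rewrite add0r big1_seq ?[RHS]nth_default ?sf //; first by lia.
  move=> l /= /[!mem_index_iota] hl; rewrite coefZ coefXn.
  have -> : (n == (g + t - l))%N = false by apply/eqP; lia.
  by rewrite mulr0.
rewrite big1_seq ?addr0 => [|l /= /[!mem_index_iota] hl]; last first.
  rewrite coefZ coefXn.
  have -> : (g + t == (g + t - l))%N = false by apply/eqP; lia.
  by rewrite mulr0.
move/monicP: mf; rewrite /lead_coef sf => <-; congr (f`_ _); lia.
Qed.

Lemma size_pE t : (t <= g)%N -> (0 < t)%N -> (size (pE g f t) <= (g + t).+1)%N.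
Proof.
move=> tg t0; apply/leq_sizeP => n hn; rewrite coef_pE //; last by lia.
by rewrite nth_default // sf; lia.
Qed.

(** For [i <= g - t] the product needs no reduction and its coefficient of degree 2g is read off.
    For larger [i], subtracting the right monomial multiple of [f] cancels every coefficient from
    degree 2g on. *)
Lemma tau_Xn_pE i t : (i < g)%N -> (t <= g)%N -> (0 < t)%N ->
  tau g f ('X^i * pE g f t) = (i == (g - t)%N)%:R.
Proof.
move=> ig tg t0; have [it|it] := leqP i (g - t)%N.
  rewrite /tau modp_small; last first.
    rewrite (leq_ltn_trans (size_polyMleq _ _)) // size_polyXn sf.
    by move: (size_pE tg t0); move: (size (pE g f t)) => x; lia.
  rewrite coefXnM; case: ifP => [|_]; first by lia.
  have [->|ni] := eqVneq.
    rewrite coef_pE //; last by lia.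
    move/monicP: mf; rewrite /lead_coef sf => <-; congr (f`_ _); lia.
  by rewrite nth_default // (leq_trans (size_pE tg t0)) //; move/eqP: ni; lia.
have -> : (i == (g - t)%N) = false by apply/eqP; lia.
have -> : 'X^i * pE g f t = 'X^((i - (g - t)).-1) * f
   + ('X^i * pE g f t - 'X^((i - (g - t)).-1) * f) by ring.
rewrite tauD tau_mull add0r tau_small //; apply/leq_sizeP => n hn.
rewrite coefB !coefXnM; case: ifP => [|_]; first by lia.
case: ifP => [|_]; first by lia.
rewrite coef_pE //; last by lia.
apply/eqP; rewrite subr_eq0; apply/eqP; congr (f`_ _); lia.
Qed.

Lemma psi_pE P s : (size P <= g)%N -> (s < g)%N -> psi g f P (pE g f (g - s)) = P`_s.
Proof.
move=> sP sg; rewrite /psi.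
have -> : P = \sum_(i < g) P`_i *: 'X^i.
  by rewrite -poly_def; apply/polyP => i; rewrite coef_poly; case: ltnP => // gi;
     rewrite nth_default // (leq_trans sP).
rewrite mulr_suml tau_sum (bigD1 (Ordinal sg)) //= big1 ?addr0; last first.
  move=> i /eqP si; rewrite -scalerAl tauZ tau_Xn_pE ?(leq_subr, subn_gt0) //.
  have -> : (i == (g - (g - s))%N :> nat) = false; last by rewrite mulr0.
  by apply/eqP => h; apply: si; apply/val_inj => /=; lia.
rewrite -scalerAl tauZ tau_Xn_pE ?(leq_subr, subn_gt0) // subKn ?(ltnW sg) // eqxx.
rewrite mulr1 coef_sum (bigD1 (Ordinal sg)) //= big1 ?addr0 => [|i].
  by rewrite coefZ coefXn eqxx mulr1.
rewrite coefZ coefXn => h; have -> : (s == i) = false; last by rewrite mulr0.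
by apply/eqP => e; move/eqP: h; apply; apply/val_inj.
Qed.

Lemma psi_Xn_low P s : (size P <= g)%N -> (s <= g)%N -> psi g f P 'X^s = 0.
Proof.
move=> sP sg; rewrite /psi tau_small //.
have [->|P0] := eqVneq P 0; first by rewrite mul0r size_poly0.
by rewrite size_mulXn //; lia.
Qed.

End Tau.

(** * Coordinates of the pure spinor *)

Lemma natf_neq0_rat (k : fieldExtType rat) (n : nat) : (n.+1%:R : k) != 0.
Proof. by rewrite -(rmorph_nat (in_alg k)) fmorph_eq0 pnatr_eq0. Qed.

Section Spinor.
Variables (k : fieldExtType rat) (g : nat) (f U V Rp : {poly k}).
Hypotheses (mf : f \is monic) (sf : size f = (2 * g + 2)%N).
Hypothesis hM : mumford_triple g f U V Rp.
Variable w : spinor_t k g.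
Hypothesis hw : pure_spinor f (Psi_gens g U V Rp) w.

Let m := (size U).-1.

Let mU : U \is monic. Proof. by case: hM. Qed.
Let mg : (m <= g)%N. Proof. by case: hM. Qed.
Let sU : size U = m.+1.
Proof. by rewrite /m prednK // size_poly_gt0 monic_neq0. Qed.
Let Um : U`_m = 1. Proof. by move/monicP: mU. Qed.

Lemma nth_Psi_gens_kills (i : nat) : (i < size (Psi_gens g U V Rp))%N ->
  cliff_act f (Psi_gens g U V Rp)`_i w = 0.
Proof.
move=> si; case: hw => _ /(_ (Psi_gens g U V Rp)`_i) [_ ]; apply.
exists (fun l => (l == i)%:R); rewrite (bigD1 (Ordinal si)) //= eqxx scale1r.
rewrite big1 ?addr0 ?subrr ?dvdp0 // => l /eqP li.
case: eqP => [e|]; last by rewrite scale0r.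
by case: li; apply: val_inj.
Qed.

Lemma XnU_kills r : (r < g - m)%N -> cliff_act f ('X^r * U) w = 0.
Proof.
move=> hr; have := @nth_Psi_gens_kills r.
rewrite /Psi_gens size_cat !size_map !size_iota nth_cat size_map size_iota -/m hr.
by rewrite (nth_map 0%N) ?size_iota // nth_iota //; apply; rewrite ltn_addr.
Qed.

Definition Psi_gen2 (i : nat) : {poly k} :=
  (-2) *: ('X^i * V) + ('X^i * V) %% U + ((-2) *: ('X^i * Rp)) %/ U * Rp.

Lemma Psi_gen2_kills i : (i < m)%N -> cliff_act f (Psi_gen2 i) w = 0.
Proof.
move=> hi; have := @nth_Psi_gens_kills (g - m + i)%N.
rewrite /Psi_gens size_cat !size_map !size_iota nth_cat size_map size_iota -/m.
rewrite (_ : (g - m + i < g - m)%N = false) ?addKn; last by lia.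
rewrite (nth_map 0%N) ?size_iota // nth_iota //; apply.
by rewrite ltn_add2l.
Qed.

(* With [a = X^i V mod U] and [b = -2 X^i R mod U] one has
   [U q = -2 X^i f + U a - b R], so that [q / f] and [-2 X^i / U] have the same
   residues against [X^s], [s <= g]. *)
Lemma psi_gen2 i s : (i < m)%N -> (s <= g)%N ->
  psi g f (Psi_gen2 i) 'X^s = -2 * (('X^i * 'X^s) %% U)`_m.-1.
Proof.
move=> im sg; have m0 : (0 < m)%N by case: (m) im.
pose a := ('X^i * V) %% U; pose b := ((-2) *: ('X^i * Rp)) %% U.
have sa : (size a <= m)%N by rewrite -ltnS -sU ltn_modp monic_neq0.
have sb : (size b <= m)%N by rewrite -ltnS -sU ltn_modp monic_neq0.
have [_ _ _ _ [sR eUV]] := hM.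
rewrite /psi /tau.
rewrite (@coef_modp_residue k f U _ ((-2) *: 'X^i) (U * a - b * Rp) m.-1 (2 * g) s) //.
- by rewrite -scalerAl modpZl coefZ.
- by rewrite sf addn2.
- by rewrite sU prednK.
- rewrite /Psi_gen2 -/a.
  have := divp_eq ((-2) *: ('X^i * Rp)) U; rewrite -/b; set Q := _ %/ U => eQ.
  have {}eQ : U * Q = (-2) *: ('X^i * Rp) - b by rewrite eQ; ring.
  rewrite !mulrDr [U * (Q * Rp)]mulrA eQ -scalerAr mulrCA -eUV -!mul_polyC; ring.
rewrite mulrC.
have -> : (m.-1.+1 + 2 * g)%N = (m + 2 * g)%N by rewrite prednK.
set r := _ - _.
have sr : (size r <= 2 * m)%N.
  rewrite (leq_trans (size_polyD _ _)) // geq_max size_polyN.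
  rewrite !(leq_trans (size_polyMleq _ _)) //; first last.
  - by rewrite sU; move: (size a) sa => x; lia.
  - by move: (size b) (size Rp) sb sR => x y; rewrite -/m; lia.
have [->|r0] := eqVneq r 0; first by rewrite mul0r size_poly0.
by rewrite size_mulXn //; move: (size r) sr => x; lia.
Qed.

(** ['X^r * U] has degree below [g], so it lies in F and acts by contraction alone. Here and below,
    an index [j] stands for the exponent [g - 1 - j]. *)
Lemma contr_rel r (J : {set 'I_g}) : (r < g - m)%N ->
  \sum_(j < g | j \notin J)
     ('X^r * U)`_(g - 1 - j) * sgn_above k J j * w (j |: J) = 0.
Proof.
move=> hr; have sP : (size ('X^r * U)%R <= g)%N.
  by rewrite mulrC size_mulXn ?monic_neq0 // sU; lia.
have /ffunP/(_ J) := XnU_kills hr; rewrite !ffunE psi_Xn_low // mul0r addr0.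
rewrite big1 => [|j _]; last by rewrite psi_Xn_low ?mul0r // -subnDA leq_subr.
rewrite add0r (bigID (fun j => j \in J)) /= big1 => [|j jJ]; last first.
  by rewrite ffunE jJ mulr0.
rewrite add0r => h; apply: (@mulfI _ (2 : k)).
  exact: (natf_neq0_rat k 1).
rewrite mulr0 mulr_sumr -[RHS]h; apply: eq_bigr => j /negPf jJ; rewrite ffunE jJ.
have gj : (j.+1 = g - (g - 1 - j))%N by have := ltn_ord j; lia.
rewrite [in psi _ _ _ _]gj psi_pE //; last by have := ltn_ord j; lia.
ring.
Qed.

(** The hypothesis removes the contraction part of the action at [J]. By [psi_gen2], what remains
    for [Psi_gen2 i] is, up to the factor -2, the residue modulo [U] of ['X^i] times the polynomial
    displayed; all these residues vanish, so [dvdp_residue] applies. *)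
Lemma gen2_dvd (J : {set 'I_g}) :
  (forall j, j \notin J -> w (j |: J) = 0) ->
  U %| \sum_(j in J) (sgn_above k (J :\ j) j * w (J :\ j)) *: 'X^(g - 1 - j)
       + ((-1) ^+ #|J| * w J) *: 'X^g.
Proof.
move=> hJ; apply: (dvdp_residue mU sU) => i im.
have /ffunP/(_ J) := Psi_gen2_kills im; rewrite !ffunE.
rewrite [X in _ + X + _]big1 => [|j _]; last first.
  by rewrite ffunE; case: ifP => jJ; rewrite ?mulr0 // hJ ?jJ // !mulr0.
rewrite addr0 psi_gen2 // (bigID (fun j => j \in J)) /=.
rewrite [X in _ + X + _]big1 => [|j /negPf jJ]; last by rewrite ffunE jJ mulr0.
rewrite addr0 mulrDr modpD coefD mulr_sumr.
rewrite (big_morph (fun p : {poly k} => p %% U) (fun p q => modpD U p q) (mod0p U)).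
rewrite coef_sum -scalerAr modpZl coefZ => h.
apply: (@mulfI _ (-2 : k)); first by rewrite oppr_eq0 (natf_neq0_rat k 1).
rewrite mulr0 -[RHS]h mulrDr mulr_sumr; congr (_ + _); last by ring.
apply: eq_bigr => j jJ; rewrite -scalerAr modpZl coefZ psi_gen2 //; last first.
  by rewrite -subnDA leq_subr.
rewrite ffunE jJ; ring.
Qed.

(** The exponents [g - 1 - j] of its members are 0, ..., m - 1, the monomial basis of k[x]/(U);
    among the p_i these are p_{2g-m+1}, ..., p_{2g}. *)
Definition low_set : {set 'I_g} := [set j : 'I_g | (g - 1 - j < (size U).-1)%N].

Lemma sgn_above_neq0 (J : {set 'I_g}) j : sgn_above k J j != 0.
Proof. by rewrite /sgn_above signr_eq0. Qed.

(** Descending induction on the size of [T], then induction on the sum of its exponents: the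
    divisibility by [U] goes down in size inside [low_set], and contraction lowers exponents that
    are at least [m]. *)
Lemma spinor_eq0 : w low_set = 0 -> forall T, w T = 0.
Proof.
move=> wL; suff H n (T : {set 'I_g}) : (g < #|T| + n)%N -> w T = 0.
  by move=> T; apply: (H g.+1); lia.
elim: n T => [|n IHn] T.
  by rewrite addn0 ltnNge -[X in (_ <= X)%N](card_ord g) max_card.
move=> hT; have IH (T' : {set 'I_g}) : (#|T| < #|T'|)%N -> w T' = 0.
  by move=> h; apply: IHn; lia.
pose weight (A : {set 'I_g}) := (\sum_(j in A) (g - 1 - j))%N.
have [N] := ubnP (weight T); elim: N => // N IHN in T hT IH *; rewrite ltnS => hN.
(* Inside [low_set], add a missing [j1]: [gen2_dvd] at [j1 |: T] produces a multiple of [U] of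
   degree below [m], hence 0, and [w T] is one of its coefficients up to sign. *)
have [TL|] := boolP (T \subset low_set).
  have [->//|] := eqVneq T low_set; rewrite finset.eqEsubset TL /= => /subsetPn[j1 j1L j1T].
  pose J := j1 |: T; have cJ : #|J| = #|T|.+1 by rewrite cardsU1 j1T.
  have JT : J :\ j1 = T by rewrite setU1K.
  have hJ j : j \notin J -> w (j |: J) = 0.
    by move=> jJ; apply: IH; rewrite cardsU1 jJ cJ; lia.
  have := gen2_dvd hJ; rewrite [w J]IH ?cJ // mulr0 scale0r addr0.
  set B := \sum_(j in J) _ => dB.
  have sB : (size B <= m)%N.
    rewrite (leq_trans (size_sum _ _ _)) //; apply/bigmax_leqP => j jJ.
    rewrite (leq_trans (size_scale_leq _ _)) // size_polyXn.
    move: jJ; rewrite in_setU1 => /predU1P[->|/(fintype.subsetP TL)].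
      by move: j1L; rewrite inE.
    by rewrite inE.
  have B0 : B = 0.
    by apply/eqP/negPn/negP => /dvdp_leq/(_ dB); rewrite sU leqNgt ltnS sB.
  have : B`_(g - 1 - j1) = 0 by rewrite B0 coef0.
  rewrite /B coef_sum (bigD1 j1) ?setU11 //= big1 ?addr0 => [|j /andP[_ /eqP jj1]].
    rewrite coefZ coefXn eqxx mulr1 JT => /eqP.
    by rewrite mulf_eq0 (negPf (sgn_above_neq0 _ _)) => /eqP.
  rewrite coefZ coefXn; case: eqP => [e|]; last by rewrite mulr0.
  by case: jj1; apply: val_inj => /=; have := ltn_ord j; have := ltn_ord j1; lia.
case/subsetPn => j0 j0T; rewrite inE -leqNgt -/m => j0L.
have j0g := ltn_ord j0.
(* The generator whose leading exponent is that of [j0] expresses [w T] through sets of the same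
   size in which [j0] is replaced by a smaller exponent. *)
pose J := T :\ j0; have JT : j0 |: J = T by rewrite finset.setD1K.
have j0J : j0 \notin J by rewrite !inE eqxx.
have := @contr_rel (g - 1 - j0 - m)%N J; rewrite (bigD1 j0) //= big1 ?addr0.
  rewrite coefXnM JT (_ : (g - 1 - j0 < g - 1 - j0 - m)%N = false); last by lia.
  rewrite (_ : (g - 1 - j0 - (g - 1 - j0 - m))%N = m); last by lia.
  rewrite Um mul1r => h; have /h/eqP : (g - 1 - j0 - m < g - m)%N by lia.
  by rewrite mulf_eq0 (negPf (sgn_above_neq0 _ _)) => /eqP.
move=> j /andP[jJ /eqP jj0]; have jg := ltn_ord j.
have jj0' : j <> j0 :> nat by move=> e; apply: jj0; apply: val_inj.
rewrite coefXnM; case: ifP => h; first by rewrite !mul0r.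
have [h'|h'] := leqP (g - 1 - j) (g - 1 - j0); last first.
  by rewrite nth_default ?mul0r // sU; lia.
have cT : #|j |: J| = #|T| by rewrite cardsU1 jJ (cardsD1 j0 T) j0T.
rewrite [w _](IHN) ?mulr0 //; first by rewrite cT.
- by move=> T' ; rewrite cT; apply: IH.
rewrite (leq_trans _ hN) // /weight (big_setU1 _ jJ) (big_setD1 j0 j0T) /=.
by rewrite ltn_add2r; lia.
Qed.

Lemma spinor_low_neq0 : w low_set != 0.
Proof.
apply/eqP => /spinor_eq0 h; case: hw => /eqP w0 _; apply: w0.
by apply/ffunP => T; rewrite h ffunE.
Qed.

Lemma spinor_coef i : (i <= m)%N ->
  exists (J : {set 'I_g}) (b : bool), w J = (-1) ^+ b * (w low_set * U`_i).
Proof.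
rewrite leq_eqVlt => /predU1P[->|im].
  by exists low_set, false; rewrite Um mulr1 mul1r.
have ig : (i < g)%N by lia.
have hi : (g - 1 - i < g)%N by lia.
pose ji := Ordinal hi.
have sgnE (J : {set 'I_g}) j : exists b : bool, sgn_above k J j = (-1) ^+ b.
  by exists (odd #|[set i0 in J | (j < i0)%N]|); rewrite signr_odd.
have jiL : ji \in low_set by rewrite inE /= -/m; lia.
(* For [m = g] there are no generators ['X^r * U]. Then [low_set] is everything, and the polynomial
   of [gen2_dvd] at the full set, being a multiple of [U] of degree at most [g], must equal
   [c *: U]. *)
have [mg'|mg'] := ltnP m g; last first.
  have em : m = g by apply/eqP; rewrite eqn_leq mg mg'.
  have LT : low_set = finset.setTfor 'I_g.
    by apply/setP => j; rewrite !inE -/m em; have := ltn_ord j; lia.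
  have hT j : j \notin finset.setTfor 'I_g -> w (j |: finset.setTfor 'I_g) = 0 by rewrite inE.
  have := gen2_dvd hT.
  set c := _ * w (finset.setTfor _); set B := \sum_(j in _) _ => dB.
  have sB : (size B <= g)%N.
    rewrite (leq_trans (size_sum _ _ _)) //; apply/bigmax_leqP => j _.
    by rewrite (leq_trans (size_scale_leq _ _)) // size_polyXn; have := ltn_ord j; lia.
  have dD : U %| B + c *: 'X^g - c *: U.
    by rewrite dvdp_sub // -mul_polyC dvdp_mull.
  have D0 : B + c *: 'X^g - c *: U = 0.
    apply/eqP/negPn/negP => /dvdp_leq/(_ dD); rewrite sU leqNgt ltnS em.
    apply/negP/negPn/leq_sizeP => n; rewrite leq_eqVlt => /predU1P[<-|gn].
      have Bg : B`_g = 0 by rewrite nth_default.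
      have Ug : U`_g = 1 by rewrite -[in LHS]em.
      by rewrite coefB coefD !coefZ coefXn eqxx Bg Ug add0r subrr.
    have Bn : B`_n = 0 by rewrite nth_default // (leq_trans sB (ltnW gn)).
    have Un : U`_n = 0 by rewrite nth_default // sU em.
    by rewrite coefB coefD !coefZ coefXn (gtn_eqF gn) Bn Un !mulr0 addr0 subr0.
  have [b1 eb1] := sgnE (finset.setTfor 'I_g :\ ji) ji.
  exists (finset.setTfor 'I_g :\ ji), (b1 (+) odd #|finset.setTfor 'I_g|); rewrite LT.
  have : (B + c *: 'X^g - c *: U)`_i = 0 by rewrite D0 coef0.
  rewrite coefB coefD !coefZ coefXn (ltn_eqF ig) mulr0 addr0 => /eqP.
  rewrite subr_eq0 /B coef_sum (bigD1 ji) ?inE //= big1 => [|j /andP[_ /eqP jj]].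
    rewrite addr0 coefZ coefXn (_ : i == _); last by apply/eqP; lia.
    rewrite mulr1 eb1 => /eqP e.
    rewrite signr_addb signr_odd -[LHS](signrMK b1) -mulrA; congr (_ * _).
    by rewrite e /c; ring.
  rewrite coefZ coefXn; case: eqP => [e|]; last by rewrite mulr0.
  by case: jj; apply: val_inj => /=; have := ltn_ord j; lia.
have hm : (g - 1 - m < g)%N by lia.
pose jm := Ordinal hm.
pose J := low_set :\ ji.
have JL : ji |: J = low_set by rewrite finset.setD1K.
have jiJ : ji \notin J by rewrite !inE eqxx.
have jmi : jm != ji by apply/eqP => /(congr1 val) /=; lia.
have jmJ : jm \notin J by rewrite !inE /= -/m (negPf jmi) /=; lia.
(* With [r = 0] only exponents up to [m] contribute, and outside [J] these are [i] and [m]: the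
   relation has two terms. *)
have := @contr_rel 0%N J; rewrite (bigD1 ji) //= (bigD1 jm) ?jmJ //=.
rewrite big1 => [|j /andP[/andP[jJ /eqP jji] /eqP jjm]]; last first.
  rewrite mul1r nth_default ?mul0r // sU; move: jJ; rewrite !inE -/m.
  have jg := ltn_ord j; case: eqP => //= _ jm'.
  have : j <> jm :> nat by move=> e; apply: jjm; apply: val_inj.
  by move=> /=; lia.
rewrite addr0 !mul1r JL (_ : (g - 1 - (g - 1 - m))%N = m) ?Um; last by lia.
rewrite (_ : (g - 1 - (g - 1 - i))%N = i); last by lia.
rewrite mul1r => h; have {}h := h (_ : (0 < g - m)%N); rewrite subn_gt0 in h.
have [b1 eb1] := sgnE J ji; have [b2 eb2] := sgnE J jm.
exists (jm |: J), (~~ (b1 (+) b2)); move: (h mg'); rewrite eb1 eb2 => /eqP.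
rewrite addrC addr_eq0 => /eqP e; rewrite -[LHS](signrMK b2) e.
rewrite -addTb !signr_addb; ring.
Qed.
End Spinor.

(** * Absolute values *)

Section AbsValue.
Variables (R : realType) (F : fieldType).

Definition abs_value (v : F -> R) : Prop :=
  [/\ v 0 = 0, (forall x, x != 0 -> 0 < v x),
      (forall x y, v (x * y) = v x * v y) &
      (forall x y, v (x + y) <= v x + v y)].

Variable v : F -> R.
Hypothesis hv : abs_value v.

Lemma av0 : v 0 = 0. Proof. by case: hv. Qed.
Lemma av_gt0 x : x != 0 -> 0 < v x. Proof. by case: hv => _ + _ _; apply. Qed.
Lemma avM x y : v (x * y) = v x * v y. Proof. by case: hv. Qed.
Lemma avD x y : v (x + y) <= v x + v y. Proof. by case: hv. Qed.

Lemma av_ge0 x : 0 <= v x.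
Proof. by have [->|/av_gt0/ltW//] := eqVneq x 0; rewrite av0. Qed.

Lemma av1 : v 1 = 1.
Proof.
have h : v 1 != 0 by rewrite gt_eqF // av_gt0 // oner_eq0.
by apply: (mulfI h); rewrite -avM !mulr1.
Qed.

Lemma avN x : v (- x) = v x.
Proof.
rewrite -mulN1r avM; suff -> : v (-1) = 1 by rewrite mul1r.
have /eqP : v (-1) ^+ 2 = 1 by rewrite expr2 -avM mulrNN mulr1 av1.
rewrite sqrf_eq1 => /orP[/eqP//|/eqP h].
by have := av_ge0 (-1); rewrite h oppr_ge0 ler10.
Qed.

Lemma avB x y : v (x - y) <= v x + v y.
Proof. by rewrite -(avN y) avD. Qed.

Lemma avBC x y : v (x - y) = v (y - x).
Proof. by rewrite -avN opprB. Qed.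

Lemma avX x n : v (x ^+ n) = v x ^+ n.
Proof. by elim: n => [|n IH]; rewrite ?expr0 ?av1 // !exprS avM IH. Qed.

Lemma avV x : v x^-1 = (v x)^-1.
Proof.
have [->|x0] := eqVneq x 0; first by rewrite invr0 av0 invr0.
have h : v x != 0 by rewrite gt_eqF // av_gt0.
by apply: (mulfI h); rewrite -avM !divff // av1.
Qed.

Lemma av_sum (I : Type) (r : seq I) (P : pred I) (G : I -> F) :
  v (\sum_(i <- r | P i) G i) <= \sum_(i <- r | P i) v (G i).
Proof.
elim/big_rec2: _ => [|i y x _ h]; first by rewrite av0.
by rewrite (le_trans (avD _ _)) // lerD2l.
Qed.

Lemma av_prod (I : Type) (r : seq I) (P : pred I) (G : I -> F) :
  v (\prod_(i <- r | P i) G i) = \prod_(i <- r | P i) v (G i).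
Proof. exact: (big_morph v avM av1). Qed.

Lemma av_sign (b : bool) x : v ((-1) ^+ b * x) = v x.
Proof. by case: b; rewrite ?expr1 ?expr0 ?mulN1r ?mul1r ?avN. Qed.

Lemma av_triangle x y z : v (x - z) <= v (x - y) + v (y - z).
Proof. by rewrite -(subrKA y) avD. Qed.

End AbsValue.

Lemma expr_unbounded (R : realType) (a K : R) : 1 < a -> exists N, K < a ^+ N.
Proof.
move=> a1; pose e := a - 1; have e0 : 0 < e by rewrite subr_gt0.
have bern n : 1 + n%:R * e <= a ^+ n.
  elim: n => [|n IH]; first by rewrite mul0r addr0 expr0.
  rewrite exprS; have := ler_wpM2l (ltW (lt_trans ltr01 a1)) IH.
  apply: le_trans; have -> : a = 1 + e by rewrite /e; ring.
  have : 0 <= n%:R * e * e by rewrite !mulr_ge0 // ltW.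
  rewrite -natr1; nra.
pose N1 := Num.truncn (K / e); exists N1.+1.
apply: lt_le_trans (bern _).
have : K / e < N1.+1%:R by apply: truncnS_gt.
rewrite ltr_pdivrMr //; lra.
Qed.

Lemma expr_small (R : realType) (a d : R) :
  0 <= a -> a < 1 -> 0 < d -> exists N, forall n, (N <= n)%N -> a ^+ n < d.
Proof.
move=> a0 a1 d0; move: a0; rewrite le_eqVlt => /predU1P[<-|a0].
  by exists 1%N => -[//|n] _; rewrite expr0n.
have [|N hN] := @expr_unbounded R a^-1 d^-1; first by rewrite invf_gt1.
exists N => n /subnK <-; rewrite exprD.
have : a ^+ N < d by rewrite -ltf_pV2 ?posrE ?exprn_gt0 // -exprVn.
apply: le_lt_trans; rewrite ger_pMl ?exprn_gt0 //.
by rewrite exprn_ile1 // ltW.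
Qed.

(** The device that removes constants from multiplicative estimates: were [b < a], the powers of
    [a / b] would exceed [K]. *)
Lemma expr_dominated (R : realType) (a b K : R) : 0 <= a -> 0 < b ->
  (forall n, a ^+ n <= K * b ^+ n) -> a <= b.
Proof.
move=> a0 b0 h; rewrite leNgt; apply/negP => ba.
have [|N hN] := @expr_unbounded R (a / b) K; first by rewrite ltr_pdivlMr ?mul1r.
have := h N; rewrite leNgt; move: hN; rewrite expr_div_n ltr_pdivlMr ?exprn_gt0 //.
by move->.
Qed.

(** * The spectral radius on a number field *)

Lemma ratr_alg (k : fieldExtType rat) (q : rat) : ratr q = q%:A :> k.
Proof. by rewrite -(fmorph_eq_rat (in_alg k)). Qed.

Section Coordinates.
Variables (k : fieldExtType rat).
Notation n := (\dim {:k}).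

Definition bas (i : 'I_n) : k := (vbasis {:k})`_i.
Definition crd (i : 'I_n) : k -> rat := coord (vbasis {:k}) i.

Lemma crd_sum x : x = \sum_i crd i x *: bas i.
Proof. by rewrite {1}(coord_vbasis (memvf x)). Qed.

Lemma crdD i x y : crd i (x + y) = crd i x + crd i y.
Proof. by rewrite /crd linearD. Qed.
Lemma crdZ i q x : crd i (q *: x) = q * crd i x.
Proof. by rewrite /crd linearZ. Qed.
Lemma crd_linsum (I : Type) (r : seq I) (P : pred I) (G : I -> k) i :
  crd i (\sum_(j <- r | P j) G j) = \sum_(j <- r | P j) crd i (G j).
Proof. by rewrite /crd linear_sum. Qed.
Lemma crd_bas i j : crd i (bas j) = (i == j)%:R.
Proof.
have h := coord_free j i (basis_free (vbasisP {:k})).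
by rewrite /crd /bas h eq_sym.
Qed.

Lemma bas_neq0 i : bas i != 0.
Proof.
apply/eqP => h; have := crd_bas i i; rewrite h eqxx -(scale0r (0 : k)) crdZ mul0r.
by move/eqP; rewrite eq_sym oner_eq0.
Qed.

End Coordinates.

Section SupNorm.
Variables (R : realType) (k : fieldExtType rat) (v0 : rat -> R).
Hypothesis hv0 : abs_value v0.
Notation n := (\dim {:k}).
Implicit Types x y z : k.

Definition nrm x : R := \sum_(i < n) v0 (crd i x).

Lemma nrm_ge0 x : 0 <= nrm x.
Proof. by apply: sumr_ge0 => i _; apply: av_ge0. Qed.

Lemma crd_le_nrm i x : v0 (crd i x) <= nrm x.
Proof.
by rewrite /nrm (bigD1 i) //= lerDl sumr_ge0 // => j _; apply: av_ge0.
Qed.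

Lemma nrmD x y : nrm (x + y) <= nrm x + nrm y.
Proof.
by rewrite /nrm -big_split ler_sum // => i _; rewrite crdD avD.
Qed.

Lemma nrmZ q x : nrm (q *: x) = v0 q * nrm x.
Proof. by rewrite /nrm mulr_sumr; apply: eq_bigr => i _; rewrite crdZ avM. Qed.

Lemma nrm0 : nrm 0 = 0.
Proof. by rewrite -(scale0r 0) nrmZ av0 // mul0r. Qed.

Lemma nrm_sum (I : Type) (r : seq I) (P : pred I) (G : I -> k) :
  nrm (\sum_(i <- r | P i) G i) <= \sum_(i <- r | P i) nrm (G i).
Proof.
elim/big_rec2: _ => [|i y x _ h]; first by rewrite nrm0.
by rewrite (le_trans (nrmD _ _)) // lerD2l.
Qed.

Lemma nrmMn x m : nrm (x *+ m) <= nrm x *+ m.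
Proof.
elim: m => [|m IH]; first by rewrite nrm0.
by rewrite !mulrS (le_trans (nrmD _ _)) // lerD2l.
Qed.

Lemma nrm_gt0 x : x != 0 -> 0 < nrm x.
Proof.
move=> x0; rewrite lt0r nrm_ge0 andbT; apply: contra x0 => /eqP h.
rewrite (crd_sum x) big1 // => i _.
have [->|/(av_gt0 hv0)] := eqVneq (crd i x) 0; first by rewrite scale0r.
by rewrite ltNge; case/negP; rewrite -h; apply: crd_le_nrm.
Qed.

(** A bound for the structure constants of the basis; the summand 1 makes it positive. *)
Definition nrm_cst : R := 1 + \sum_(i < n) \sum_(j < n) nrm (bas i * bas j).

Lemma nrm_cst_gt0 : 0 < nrm_cst.
Proof.
rewrite ltr_pwDl //; apply: sumr_ge0 => i _; apply: sumr_ge0 => j _.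
exact: nrm_ge0.
Qed.

Lemma nrmM x y : nrm (x * y) <= nrm_cst * nrm x * nrm y.
Proof.
have -> : x * y = \sum_i \sum_j (crd i x * crd j y) *: (bas i * bas j).
  rewrite {1}(crd_sum x) {1}(crd_sum y) mulr_suml; apply: eq_bigr => i _.
  rewrite mulr_sumr; apply: eq_bigr => j _.
  by rewrite -scalerAl -scalerAr scalerA.
rewrite (le_trans (nrm_sum _ _ _)) // -mulrA mulrDl mul1r.
rewrite ler_wpDl ?mulr_ge0 ?nrm_ge0 // mulr_suml ler_sum // => i _.
rewrite (le_trans (nrm_sum _ _ _)) // mulr_suml ler_sum // => j _.
rewrite nrmZ mulrC ler_wpM2l ?nrm_ge0 // avM //.
by rewrite ler_pM ?av_ge0 ?crd_le_nrm.
Qed.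

End SupNorm.

(* [rho] is the spectral radius [lim ||x^m||^(1/m)], described without limits. *)
Section SpectralRadius.
Variables (R : realType) (k : fieldExtType rat) (v0 : rat -> R).
Hypothesis hv0 : abs_value v0.
Implicit Types x y z : k.
Notation nrm := (nrm v0).
Notation C := (nrm_cst k v0).

Definition growth_rate x : set R :=
  [set a | 0 < a /\ exists K, forall m, nrm (x ^+ m) <= K * a ^+ m].

Definition rho x : R := inf (growth_rate x).

Lemma growth_rate_gt0 x a : growth_rate x a -> 0 < a. Proof. by case. Qed.

Lemma growth_rate_bound x a : growth_rate x a ->
  exists2 K, 0 <= K & forall m, nrm (x ^+ m) <= K * a ^+ m.
Proof.
case=> a0 [K h]; exists K => //; have := h 0%N; rewrite !expr0 mulr1.
by apply: le_trans; apply: (nrm_ge0 hv0).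
Qed.

Lemma growth_rate_nonempty x : exists a, growth_rate x a.
Proof.
have C0 := @nrm_cst_gt0 _ k v0 hv0; have N0 := nrm_ge0 hv0 x.
exists (C * nrm x + 1); split; first by rewrite ltr_wpDl ?mulr_ge0 // ltW.
exists (nrm (1 : k)); elim=> [|m IH]; first by rewrite !expr0 mulr1.
rewrite exprS (le_trans (nrmM hv0 _ _)) // exprS mulrCA.
apply: ler_pM => //; first by rewrite mulr_ge0 // ltW.
  exact: nrm_ge0.
by rewrite lerDl.
Qed.

Lemma growth_rate_has_inf x : has_inf (growth_rate x).
Proof.
by split; [exact: growth_rate_nonempty | exists 0 => a /growth_rate_gt0/ltW].
Qed.

Lemma rho_ge0 x : 0 <= rho x.
Proof.
by apply: lb_le_inf; [exact: growth_rate_nonempty | move=> a /growth_rate_gt0/ltW].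
Qed.

Lemma rho_le x a : growth_rate x a -> rho x <= a.
Proof. by apply: ge_inf; case: (growth_rate_has_inf x). Qed.

Lemma rho_lt x a : rho x < a -> growth_rate x a.
Proof.
move=> /(inf_lt (growth_rate_nonempty x))[b [b0 [K hK]] ba].
have [K1 K10 {}hK] : exists2 K, 0 <= K & forall m, nrm (x ^+ m) <= K * b ^+ m.
  by apply: growth_rate_bound; split => //; exists K.
split; first exact: lt_trans ba; exists K1 => m; rewrite (le_trans (hK m)) //.
by rewrite ler_wpM2l // lerXn2r ?nnegrE ?(ltW ba) ?(ltW b0) ?(ltW (lt_trans b0 ba)).
Qed.

Lemma rho_ler x c : (forall a, growth_rate x a -> c <= a) -> c <= rho x.
Proof. by apply: lb_le_inf; exact: growth_rate_nonempty. Qed.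

Lemma growth_rateD x y a b : growth_rate x a -> growth_rate y b -> growth_rate (x + y) (a + b).
Proof.
move=> Sx Sy; have [K K0 hK] := growth_rate_bound Sx; have [L L0 hL] := growth_rate_bound Sy.
have [a0 b0] := (growth_rate_gt0 Sx, growth_rate_gt0 Sy).
have C0 := @nrm_cst_gt0 _ k v0 hv0.
split; first exact: addr_gt0; exists (C * K * L) => m.
rewrite !exprDn mulr_sumr (le_trans (nrm_sum hv0 _ _ _)) // ler_sum // => i _.
rewrite (le_trans (nrmMn hv0 _ _)) // mulrnAr ler_wMn2r //.
rewrite (le_trans (nrmM hv0 _ _)) //.
have -> : C * K * L * (a ^+ (m - i) * b ^+ i)
   = C * ((K * a ^+ (m - i)) * (L * b ^+ i)) by ring.
rewrite -mulrA ler_wpM2l ?(ltW C0) // ler_pM ?(nrm_ge0 hv0) //.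
Qed.

Lemma growth_rateM x y a b : growth_rate x a -> growth_rate y b -> growth_rate (x * y) (a * b).
Proof.
move=> Sx Sy; have [K K0 hK] := growth_rate_bound Sx; have [L L0 hL] := growth_rate_bound Sy.
have [a0 b0] := (growth_rate_gt0 Sx, growth_rate_gt0 Sy).
have C0 := @nrm_cst_gt0 _ k v0 hv0.
split; first exact: mulr_gt0; exists (C * K * L) => m.
rewrite !exprMn (le_trans (nrmM hv0 _ _)) //.
have -> : C * K * L * (a ^+ m * b ^+ m) = C * ((K * a ^+ m) * (L * b ^+ m)) by ring.
by rewrite -mulrA ler_wpM2l ?(ltW C0) // ler_pM ?(nrm_ge0 hv0).
Qed.

Lemma growth_rate_sqr x b : growth_rate (x ^+ 2) b -> growth_rate x (Num.sqrt b).
Proof.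
move=> S2; have [K K0 hK] := growth_rate_bound S2; have b0 := growth_rate_gt0 S2.
have C0 := @nrm_cst_gt0 _ k v0 hv0.
set a := Num.sqrt b; have a0 : 0 < a by rewrite sqrtr_gt0.
have ab : a ^+ 2 = b by rewrite sqr_sqrtr // ltW.
(* Even powers of [x] are powers of [x ^+ 2]. An odd one has a further factor [x], at the cost of
   [C * nrm x]; the division by [a] balances the extra [a] on the right. *)
split => //; exists (K + C * nrm x * K / a) => m.
have Q0 : 0 <= C * nrm x * K / a by rewrite !mulr_ge0 ?invr_ge0 ?(nrm_ge0 hv0) // ltW.
have -> : m = (odd m + 2 * m./2)%N by rewrite mul2n odd_double_half.
move: (odd m) (m./2) => o h; rewrite exprD [a ^+ _]exprD !exprM ab.
have bh : 0 <= b ^+ h by rewrite exprn_ge0 // ltW.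
case: o; rewrite ?expr1 ?expr0 ?mul1r.
  rewrite (le_trans (nrmM hv0 _ _)) //.
  apply: (@le_trans _ _ (C * nrm x * (K * b ^+ h))).
    by rewrite ler_wpM2l // mulr_ge0 ?(nrm_ge0 hv0) // ltW.
  have -> : (K + C * nrm x * K / a) * (a * b ^+ h)
     = K * a * b ^+ h + (C * nrm x * (K * b ^+ h)) by field; rewrite gt_eqF.
  by rewrite lerDr !mulr_ge0 // ltW.
by rewrite (le_trans (hK h)) // ler_wpM2r // lerDl.
Qed.

Lemma growth_rate_alg q : q != 0 -> growth_rate q%:A (v0 q).
Proof.
move=> q0; split; first exact: av_gt0; exists (nrm (1 : k)) => m.
by rewrite -[_ ^+ m](rmorphXn (in_alg k)) /= nrmZ // avX // mulrC.
Qed.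

Lemma growth_rate_1 a : growth_rate 1 a -> 1 <= a.
Proof.
move=> S1; have [K K0 hK] := growth_rate_bound S1.
have n1 : 0 < nrm (1 : k) by rewrite nrm_gt0 // oner_eq0.
apply: (@expr_dominated _ _ _ (K / nrm (1 : k))) (growth_rate_gt0 S1) _ => // m.
by rewrite expr1n mulrAC ler_pdivlMr // mul1r; have := hK m; rewrite expr1n.
Qed.

Lemma rhoD x y : rho (x + y) <= rho x + rho y.
Proof.
apply/ler_addgt0Pr => e e0; have e2 : 0 < e / 2 by rewrite divr_gt0.
have Sx : growth_rate x (rho x + e / 2) by apply: rho_lt; rewrite ltrDl.
have Sy : growth_rate y (rho y + e / 2) by apply: rho_lt; rewrite ltrDl.
by rewrite (le_trans (rho_le (growth_rateD Sx Sy))) //; lra.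
Qed.

Lemma rhoM x y : rho (x * y) <= rho x * rho y.
Proof.
have key a b : growth_rate x a -> growth_rate y b -> rho (x * y) <= a * b.
  by move=> Sx Sy; apply: rho_le; apply: growth_rateM.
have key2 b : growth_rate y b -> rho (x * y) <= rho x * b.
  move=> Sy; have b0 := growth_rate_gt0 Sy; rewrite -ler_pdivrMr //.
  by apply: rho_ler => a Sx; rewrite ler_pdivrMr //; apply: key.
have [x0|x0] := eqVneq (rho x) 0.
  have [b Sy] := growth_rate_nonempty y.
  by have := key2 b Sy; rewrite x0 !mul0r.
have {}x0 : 0 < rho x by rewrite lt0r x0 rho_ge0.
rewrite [leRHS]mulrC -ler_pdivrMr //; apply: rho_ler => b Sy.
by rewrite ler_pdivrMr // [leRHS]mulrC; apply: key2.
Qed.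

Lemma rho_sqr x : rho x ^+ 2 <= rho (x ^+ 2).
Proof.
apply: rho_ler => b Sb; have b0 := growth_rate_gt0 Sb.
rewrite -[leRHS]sqr_sqrtr ?(ltW b0) // lerXn2r ?nnegrE ?rho_ge0 ?sqrtr_ge0 //.
exact: rho_le (growth_rate_sqr Sb).
Qed.

Lemma rho_alg q : rho q%:A <= v0 q.
Proof.
have [->|q0] := eqVneq q 0; last exact: rho_le (growth_rate_alg q0).
rewrite scale0r (av0 hv0); apply/ler_addgt0Pr => e e0; rewrite add0r.
apply: rho_le; split => //; exists (nrm (1 : k)) => -[|m]; first by rewrite !expr0 mulr1.
by rewrite expr0n /= nrm0 // mulr_ge0 ?(nrm_ge0 hv0) // exprn_ge0 // ltW.
Qed.

Lemma rho1 : rho 1 = 1.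
Proof.
apply/eqP; rewrite eq_le -{1}[1](scale1r (1 : k)) (le_trans (rho_alg 1)) ?(av1 hv0) //=.
by apply: rho_ler => a; apply: growth_rate_1.
Qed.

End SpectralRadius.

(** * Existence of extensions of an absolute value *)

Section SquareNorm.
Variables (R : realType) (k : fieldExtType rat) (v0 : rat -> R).
Hypothesis hv0 : abs_value v0.
Implicit Types x y z : k.

(* A minimal such [p] is multiplicative: otherwise its twists below are smaller. *)
Record sqnorm (p : k -> R) : Prop := Sqnorm {
  sq_ge0 : forall x, 0 <= p x;
  sqD : forall x y, p (x + y) <= p x + p y;
  sqM : forall x y, p (x * y) <= p x * p y;
  sqX2 : forall x, p x ^+ 2 <= p (x ^+ 2);
  sq1 : p 1 = 1;
  sqQ : forall q, p q%:A <= v0 q }.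

Lemma sqnorm_rho : sqnorm (@rho R k v0).
Proof.
split; [exact: rho_ge0|exact: rhoD|exact: rhoM|exact: rho_sqr|exact: rho1|].
exact: rho_alg.
Qed.

Lemma sq_gt0 p x : sqnorm p -> x != 0 -> 0 < p x.
Proof.
move=> hp x0; rewrite lt0r sq_ge0 // andbT; apply/eqP => px.
have := sqM hp x x^-1; rewrite divff // sq1 // px mul0r.
by rewrite leNgt ltr01.
Qed.

Lemma sq0 p : sqnorm p -> p 0 = 0.
Proof.
move=> hp; apply/eqP; rewrite eq_le sq_ge0 // andbT -(scale0r 1).
by rewrite (le_trans (sqQ hp 0)) // (av0 hv0).
Qed.

Lemma sqX_le p x m : sqnorm p -> p (x ^+ m) <= p x ^+ m.
Proof.
move=> hp; elim: m => [|m IH]; first by rewrite !expr0 sq1.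
by rewrite !exprS (le_trans (sqM hp _ _)) // ler_wpM2l // sq_ge0.
Qed.

(** Repeated squaring gives equality at the exponents [2 ^ s]. For general [m], split [2 ^ m] as
    [(2 ^ m - m) + m], apply submultiplicativity and cancel the power [2 ^ m - m] of [p x]. *)
Lemma sqX p x m : sqnorm p -> p (x ^+ m) = p x ^+ m.
Proof.
move=> hp; have [->|x0] := eqVneq x 0.
  by case: m => [|m]; rewrite ?expr0 ?sq1 // !expr0n /= sq0 // expr0n.
apply/eqP; rewrite eq_le sqX_le //=.
have pow s : p x ^+ (2 ^ s) <= p (x ^+ (2 ^ s)).
  elim: s => [|s IH]; first by rewrite !expr1.
  rewrite expnSr !exprM (le_trans _ (sqX2 hp _)) //.
  by rewrite lerXn2r ?nnegrE ?exprn_ge0 ?sq_ge0.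
have mm : (m <= 2 ^ m)%N by rewrite ltnW // ltn_expl.
have := pow m; rewrite -(subnK mm) !exprD => h.
have px := sq_gt0 hp x0.
rewrite -(ler_pM2l (exprn_gt0 (2 ^ m - m) px)) (le_trans h) //.
rewrite (le_trans (sqM hp _ _)) // ler_wpM2r ?sq_ge0 //; exact: sqX_le.
Qed.

Section InfFamily.
Variables (T : Type) (t0 : T) (F : T -> k -> R).
Hypothesis F_ge0 : forall t x, 0 <= F t x.
Hypothesis F_dir : forall t1 t2, exists t, forall x, F t x <= F t1 x /\ F t x <= F t2 x.
Hypothesis FD : forall t x y, F t (x + y) <= F t x + F t y.
Hypothesis FM : forall t1 t2, exists t, forall x y, F t (x * y) <= F t1 x * F t2 y.
Hypothesis FX2 : forall t x, exists t', F t' x ^+ 2 <= F t (x ^+ 2).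
Hypothesis F1 : forall t, F t 1 = 1.
Hypothesis FQ : exists t, forall q, F t q%:A <= v0 q.

Definition inf_fam x : R := inf [set F t x | t in [set: T]]%classic.

Lemma inf_fam_le t x : inf_fam x <= F t x.
Proof.
apply: ge_inf; last by exists t.
by exists 0 => _ [t' _ <-].
Qed.

Lemma inf_fam_ge c x : (forall t, c <= F t x) -> c <= inf_fam x.
Proof.
move=> h; apply: lb_le_inf; first by exists (F t0 x), t0.
by move=> _ [t _ <-].
Qed.

Lemma inf_fam_lt c x : inf_fam x < c -> exists t, F t x < c.
Proof.
move=> /inf_lt[]; first by exists (F t0 x), t0.
by move=> _ [t _ <-] h; exists t.
Qed.

(** Serves for two infima: the decreasing sequence that defines a twist, and a chain in Zorn's
    lemma. The hypotheses let the index change, since a member of the first family need not itself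
    be submultiplicative. *)
Lemma sqnorm_inf_fam : sqnorm inf_fam.
Proof.
have I0 x : 0 <= inf_fam x by apply: inf_fam_ge.
split=> //.
- move=> x y; apply/ler_addgt0Pr => e e0; have e2 : 0 < e / 2 by rewrite divr_gt0.
  have [t1 h1] : exists t, F t x < inf_fam x + e / 2 by apply: inf_fam_lt; rewrite ltrDl.
  have [t2 h2] : exists t, F t y < inf_fam y + e / 2 by apply: inf_fam_lt; rewrite ltrDl.
  have [t ht] := F_dir t1 t2; have [hx _] := ht x; have [_ hy] := ht y.
  by rewrite (le_trans (inf_fam_le t _)) // (le_trans (FD _ _ _)) //; lra.
- move=> x y.
  have key t1 t2 : inf_fam (x * y) <= F t1 x * F t2 y.
    by have [t ht] := FM t1 t2; rewrite (le_trans (inf_fam_le t _)).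
  have key2 t2 : inf_fam (x * y) <= inf_fam x * F t2 y.
    have [y0|y0] := eqVneq (F t2 y) 0.
      by have := key t0 t2; rewrite y0 !mulr0.
    have {}y0 : 0 < F t2 y by rewrite lt0r y0 F_ge0.
    rewrite -ler_pdivrMr //; apply: inf_fam_ge => t1.
    by rewrite ler_pdivrMr.
  have [x0|x0] := eqVneq (inf_fam x) 0.
    by have := key2 t0; rewrite x0 !mul0r.
  have {}x0 : 0 < inf_fam x by rewrite lt0r x0 I0.
  rewrite [leRHS]mulrC -ler_pdivrMr //; apply: inf_fam_ge => t2.
  by rewrite ler_pdivrMr // [leRHS]mulrC.
- move=> x; apply: inf_fam_ge => t; have [t' ht] := FX2 t x.
  by rewrite (le_trans _ ht) // lerXn2r ?nnegrE ?F_ge0 // inf_fam_le.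
- apply/eqP; rewrite eq_le -{1}(F1 t0) inf_fam_le /=.
  by apply: inf_fam_ge => t; rewrite F1.
- by move=> q; have [t ht] := FQ; rewrite (le_trans (inf_fam_le t _)).
Qed.
End InfFamily.

(** The limit of a decreasing sequence. Shifting the index turns [x * y] into [y] times a factor
    [p x], which forces the multiplicativity at [x] recorded in [twistM]. *)
Definition twist (p : k -> R) x : k -> R :=
  inf_fam (fun m y => p (x ^+ m * y) / p x ^+ m).

Section Twist.
Variables (p : k -> R) (x : k).
Hypotheses (hp : sqnorm p) (x0 : x != 0).
Let F m y := p (x ^+ m * y) / p x ^+ m.
Let px := sq_gt0 hp x0.
Let F_ge0 m y : 0 <= F m y.
Proof. by rewrite /F divr_ge0 ?exprn_ge0 ?sq_ge0. Qed.

Let F_mono m d y : F (m + d)%N y <= F m y.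
Proof.
rewrite /F ler_pdivrMr ?exprn_gt0 // [in leRHS]exprD mulrA divfK ?expf_neq0 ?gt_eqF //.
rewrite addnC exprD -mulrA (le_trans (sqM hp _ _)) // mulrC ler_wpM2l ?sq_ge0 //.
exact: sqX_le.
Qed.

Lemma sqnorm_twist : sqnorm (twist p x).
Proof.
apply: (@sqnorm_inf_fam _ 0%N) => //.
- move=> m1 m2; exists (m1 + m2)%N => y; split; first exact: F_mono.
  by rewrite addnC; exact: F_mono.
- move=> m y z; rewrite mulrDr -mulrDl ler_wpM2r ?invr_ge0 ?exprn_ge0 ?sq_ge0 //.
  exact: sqD.
- move=> m1 m2; exists (m1 + m2)%N => y z.
  rewrite mulf_div -exprD ler_wpM2r ?invr_ge0 ?exprn_ge0 ?sq_ge0 //.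
  by rewrite exprD mulrACA sqM.
- move=> m y; exists m; rewrite expr_div_n -[X in X / _](sqX _ _ hp) exprMn.
  have pm : 0 < p x ^+ m by rewrite exprn_gt0.
  rewrite ler_pdivrMr ?exprn_gt0 // [p x ^+ m ^+ 2]expr2 [leRHS]mulrA divfK ?gt_eqF //.
  rewrite [x ^+ m ^+ 2]expr2 -mulrA (le_trans (sqM hp _ _)) // mulrC.
  by rewrite ler_wpM2l ?sq_ge0 //; exact: sqX_le.
- by move=> m; rewrite mulr1 sqX // divff // expf_neq0 ?gt_eqF.
- by exists 0%N => q; rewrite !expr0 mul1r divr1 sqQ.
Qed.

Lemma twist_le y : twist p x y <= p y.
Proof.
have := @inf_fam_le _ F F_ge0 0%N y.
by rewrite [X in _ <= X]/F !expr0 mul1r divr1.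
Qed.

Lemma twistM y : p x * twist p x y <= twist p x (x * y).
Proof.
apply: (inf_fam_ge 0%N) => m; have := @inf_fam_le _ F F_ge0 m.+1 y.
rewrite -[inf_fam F y]/(twist p x y) => h.
have -> : p (x ^+ m * (x * y)) / p x ^+ m = p x * F m.+1 y.
  rewrite /F mulrA -exprSr [p x ^+ m.+1]exprS.
  have : p x ^+ m != 0 by rewrite expf_neq0 ?gt_eqF.
  by move: (p x ^+ m) => c c0; field; rewrite c0 gt_eqF.
by rewrite ler_wpM2l // ltW.
Qed.
End Twist.

Definition ext_av : set (k -> R) :=
  [set v | is_absval v /\ forall q : rat, v (ratr q) = v0 q]%classic.

(* Any square norm below the twist of [rho] at [x] takes the value [rho x] at [x];
   a minimal one exists by Zorn's lemma and is multiplicative. *)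
Lemma ext_spectral x : x != 0 -> exists2 v, ext_av v & v x = rho v0 x.
Proof.
move=> x0; pose p1 := twist (rho v0) x.
have hp1 : sqnorm p1 by apply: sqnorm_twist => //; exact: sqnorm_rho.
pose T := {p : k -> R | sqnorm p /\ forall y, p y <= p1 y}.
(* The pointwise order reversed, so that a maximal element for Zorn's lemma is a minimal square
   norm; the empty chain is bounded by [p1]. *)
pose le_T (s t : T) := `[< forall y, sval t y <= sval s y >].
have [[p [hp pp1]] pmin] : exists t : T, forall s, le_T t s -> s = t.
  apply: (@Zorn T le_T).
  - by move=> t; apply/asboolP.
  - move=> r s t /asboolP rs /asboolP st; apply/asboolP => y.
    exact: le_trans (st y) (rs y).
  - move=> [s hs] [t ht] /asboolP /= st /asboolP /= ts.
    have e : s = t by apply/funext => y; apply/eqP; rewrite eq_le st ts.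
    by subst t; congr exist; exact: Prop_irrelevance.
  move=> A Atot; have [[a Aa]|A0] := pselect (exists a, A a); last first.
    exists (exist _ p1 (conj hp1 (fun y => lexx (p1 y)))) => s As.
    by case: A0; exists s.
  pose F (t : {t : T | A t}) := sval (sval t).
  have F_ge0 t y : 0 <= F t y by exact: (sq_ge0 (svalP (sval t)).1).
  have F_dir (t1 t2 : {t : T | A t}) :
      exists t, forall y, F t y <= F t1 y /\ F t y <= F t2 y.
    case: t1 t2 => [t1 A1] [t2 A2].
    have [/asboolP h|/asboolP h] := Atot t1 t2 A1 A2.
      by exists (exist _ t2 A2) => y; split; [exact: h|exact: lexx].
    by exists (exist _ t1 A1) => y; split; [exact: lexx|exact: h].
  have hF t : sqnorm (F t) by case: (svalP (sval t)).
  have sI : sqnorm (inf_fam F).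
    apply: (sqnorm_inf_fam (exist _ a Aa)) => //.
    - by move=> t; apply: sqD.
    - move=> t1 t2; have [t ht] := F_dir t1 t2; exists t => y z.
      rewrite (le_trans (sqM (hF t) _ _)) // ler_pM ?F_ge0 //.
        by case: (ht y).
      by case: (ht z).
    - by move=> t y; exists t; apply: sqX2.
    - by move=> t; apply: sq1.
    - by exists (exist _ a Aa) => q; apply: sqQ.
  have leI y : inf_fam F y <= p1 y.
    apply: (le_trans (@inf_fam_le _ _ F_ge0 (exist _ a Aa) y)).
    by case: (svalP a) => _; apply.
  exists (exist _ (inf_fam F) (conj sI leI)) => s As; apply/asboolP => y.
  exact: (@inf_fam_le _ _ F_ge0 (exist _ s As) y).
have pM y z : p (y * z) = p y * p z.
  have [->|y0] := eqVneq y 0; first by rewrite mul0r sq0 // mul0r.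
  apply/eqP; rewrite eq_le sqM //=.
  have st := sqnorm_twist hp y0.
  have tp1 u : twist p y u <= p1 u by rewrite (le_trans (twist_le _ hp _)).
  have e : twist p y = p.
    have : le_T (exist _ p (conj hp pp1)) (exist _ (twist p y) (conj st tp1)).
      by apply/asboolP => u; apply: twist_le.
    by move/pmin/(congr1 sval).
  by have := twistM hp y0 z; rewrite e.
have pgt0 y : y != 0 -> 0 < p y by exact: sq_gt0.
have pV y : y != 0 -> p y * p y^-1 = 1.
  by move=> y0; rewrite -pM divff // sq1.
exists p; first split.
- split=> //; [exact: sq0 | exact: sqD].
- move=> q; rewrite ratr_alg; have [->|q0] := eqVneq q 0.
    by rewrite scale0r sq0 // (av0 hv0).
  have qA0 : q%:A != 0 :> k by rewrite scaler_eq0 negb_or q0 oner_eq0.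
  apply/eqP; rewrite eq_le sqQ //=.
  (* The one-sided bound on rationals, applied to the inverse of [q] as well, becomes an
     equality. *)
  have := pV _ qA0; rewrite -[_^-1](fmorphV (in_alg k)) /= => e.
  have h := sqQ hp q^-1; rewrite (avV hv0) in h.
  have q1 := av_gt0 hv0 q0.
  rewrite -[leLHS]mulr1 -e mulrCA -[leRHS]mulr1.
  rewrite ler_wpM2l ?(ltW (pgt0 _ qA0)) //.
  by rewrite -(divff (lt0r_neq0 q1)) ler_pM2l.
have hr := sqnorm_rho; apply/eqP; rewrite eq_le.
rewrite (le_trans (pp1 x) (twist_le _ hr _)) /=.
have r0 := sq_gt0 hr x0.
(* The twist at [x] gives an upper bound for [p x^-1]; as [p] is multiplicative, this is the lower
   bound for [p x]. *)
have h1 : rho v0 x * p x^-1 <= 1.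
  apply: (@le_trans _ _ (rho v0 x * p1 x^-1)); first by rewrite ler_wpM2l ?pp1 // ltW.
  by have := twistM hr x0 x^-1; rewrite divff // -/p1 (sq1 hp1).
rewrite -[leLHS]mulr1 -(pV _ x0) mulrCA -[leRHS]mulr1.
by rewrite ler_wpM2l // ltW // pgt0.
Qed.
End SquareNorm.

(** * Norm, trace and the trace form *)

Lemma horner_char_poly_det (F : comNzRingType) (m : nat) (A : 'M[F]_m) q :
  (char_poly A).[q] = \det (q%:M - A).
Proof.
rewrite /char_poly -horner_evalE -det_map_mx; congr (\det _).
apply/matrixP => i j; rewrite /char_poly_mx !mxE /= horner_evalE !hornerE.
by case: (i == j); rewrite ?mulr1n ?mulr0n ?hornerE.
Qed.

Section NormTrace.
Variable k : fieldExtType rat.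
Notation n := (\dim {:k}).
Implicit Types x y : k.

Definition mulmat x : 'M[rat]_n := \matrix_(i, j) crd j (x * bas i).
Definition fnorm x : rat := \det (mulmat x).
Definition ftrace x : rat := \tr (mulmat x).

Lemma mulmatM x y : mulmat (x * y) = mulmat x *m mulmat y.
Proof.
apply/matrixP => i j; rewrite !mxE mulrAC [x * _ * y]mulrC [x * _ in LHS](crd_sum).
rewrite mulr_sumr crd_linsum; apply: eq_bigr => l _.
by rewrite !mxE -scalerAr crdZ.
Qed.

Lemma mulmatD x y : mulmat (x + y) = mulmat x + mulmat y.
Proof. by apply/matrixP => i j; rewrite !mxE mulrDl crdD. Qed.

Lemma mulmatZ q x : mulmat (q *: x) = q *: mulmat x.
Proof. by apply/matrixP => i j; rewrite !mxE -scalerAl crdZ. Qed.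

Lemma mulmat1 : mulmat 1 = 1%:M.
Proof. by apply/matrixP => i j; rewrite !mxE mul1r crd_bas eq_sym. Qed.

Lemma fnormM x y : fnorm (x * y) = fnorm x * fnorm y.
Proof. by rewrite /fnorm mulmatM det_mulmx. Qed.

Lemma fnorm1 : fnorm 1 = 1. Proof. by rewrite /fnorm mulmat1 det1. Qed.

Lemma fnormX x m : fnorm (x ^+ m) = fnorm x ^+ m.
Proof. by elim: m => [|m IH]; rewrite ?expr0 ?fnorm1 // !exprS fnormM IH. Qed.

Lemma fnorm_neq0 x : x != 0 -> fnorm x != 0.
Proof.
move=> x0; apply/eqP => h; have := fnormM x x^-1.
by rewrite divff // fnorm1 h mul0r => /eqP; rewrite oner_eq0.
Qed.

Lemma ftraceD x y : ftrace (x + y) = ftrace x + ftrace y.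
Proof. by rewrite /ftrace mulmatD mxtraceD. Qed.

Lemma ftraceZ q x : ftrace (q *: x) = q * ftrace x.
Proof. by rewrite /ftrace mulmatZ mxtraceZ. Qed.

Lemma ftrace_sum (I : Type) (r : seq I) (P : pred I) (G : I -> k) :
  ftrace (\sum_(i <- r | P i) G i) = \sum_(i <- r | P i) ftrace (G i).
Proof.
by apply: (big_morph _ ftraceD); rewrite -(scale0r 0) ftraceZ mul0r.
Qed.

Lemma ftrace1 : ftrace 1 = n%:R.
Proof. by rewrite /ftrace mulmat1 mxtrace1. Qed.

Definition trace_gram : 'M[rat]_n := \matrix_(i, j) ftrace (bas i * bas j).

Lemma crd_trace_gram x :
  (\row_i crd i x) *m trace_gram = \row_j ftrace (x * bas j).
Proof.
apply/rowP => j; rewrite !mxE {2}(crd_sum x) mulr_suml ftrace_sum.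
by apply: eq_bigr => i _; rewrite !mxE -scalerAl ftraceZ.
Qed.

(** An [x] orthogonal to the whole basis is orthogonal to its own inverse, but the trace of 1 is
    [n], nonzero in characteristic 0. *)
Lemma trace_gram_unit : trace_gram \in unitmx.
Proof.
rewrite unitmxE unitfE; apply/negP => /det0P[u u0 hu].
pose x := \sum_i u 0 i *: bas i.
have ux : \row_i crd i x = u.
  apply/rowP => i; rewrite mxE crd_linsum (bigD1 i) //= big1 => [|j ji].
    by rewrite crdZ crd_bas eqxx mulr1 addr0.
  by rewrite crdZ crd_bas eq_sym (negPf ji) mulr0.
have x0 : x != 0.
  apply: contra u0 => /eqP x0; rewrite -ux; apply/eqP/rowP => i.
  by rewrite !mxE x0 -(scale0r (0 : k)) crdZ mul0r.
have h (j : 'I_n) : ftrace (x * bas j) = 0.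
  have := crd_trace_gram x; rewrite ux hu => /rowP/(_ j).
  by rewrite !mxE.
have : ftrace (x * x^-1) = 0.
  rewrite [x^-1]crd_sum mulr_sumr ftrace_sum big1 // => j _.
  by rewrite -scalerAr ftraceZ h mulr0.
move/eqP; rewrite divff // ftrace1 pnatr_eq0.
by have := adim_gt0 {:k}%AS; case: (n).
Qed.

End NormTrace.

(** * The spectral radius against norm, trace and coordinates *)

Section Bounds.
Variables (R : realType) (k : fieldExtType rat) (v0 : rat -> R).
Hypothesis hv0 : abs_value v0.
Notation n := (\dim {:k}).
Implicit Types x y z : k.
Notation nrm := (nrm v0).
Notation C := (nrm_cst k v0).

Lemma av_det_le (m : nat) (A : 'M[rat]_m) (w : 'I_m -> R) :
  (forall i j, v0 (A i j) <= w j) -> v0 (\det A) <= m`!%:R * \prod_j w j.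
Proof.
move=> h; rewrite /determinant (le_trans (av_sum hv0 _ _ _)) //.
apply: (@le_trans _ _ (\sum_(s : 'S_m) \prod_j w j)); last first.
  by rewrite sumr_const card_Sn mulr_natl.
apply: ler_sum => s _; rewrite (av_sign hv0) (av_prod hv0).
rewrite [leRHS](reindex_inj (@perm_inj _ s)) /=.
by apply: ler_prod => i _; rewrite h av_ge0.
Qed.

(** The Leibniz formula for the matrix of [x ^+ m] bounds [v0 (fnorm x) ^+ m] by a constant times
    [(a ^+ n) ^+ m], and [expr_dominated] drops the constant. *)
Lemma fnorm_le_growth_rate x a : growth_rate v0 x a -> v0 (fnorm x) <= a ^+ n.
Proof.
move=> Sx; have [K K0 hK] := growth_rate_bound hv0 Sx; have a0 := growth_rate_gt0 Sx.
have C0 := ltW (@nrm_cst_gt0 _ k v0 hv0).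
pose S := \sum_(i < n) nrm (bas i).
have hS (i : 'I_n) : nrm (bas i) <= S.
  by rewrite /S (bigD1 i) //= lerDl sumr_ge0 // => j _; apply: (nrm_ge0 hv0).
apply: (@expr_dominated _ _ _ (n`!%:R * (C * K * S) ^+ n)).
- exact: (av_ge0 hv0).
- by rewrite exprn_gt0.
move=> m; rewrite -(avX hv0) -fnormX /fnorm.
pose w (j : 'I_n) := C * (K * a ^+ m) * S.
apply: (@le_trans _ _ (n`!%:R * \prod_j w j)).
  apply: av_det_le => i j; rewrite mxE (le_trans (crd_le_nrm hv0 _ _)) //.
  rewrite (le_trans (nrmM hv0 _ _)) // /w -!mulrA ler_wpM2l // mulrA.
  by rewrite ler_pM ?(nrm_ge0 hv0).
rewrite /w prodr_const card_ord -[leRHS]mulrA ler_wpM2l ?ler0n //.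
have -> : C * (K * a ^+ m) * S = C * K * S * a ^+ m by ring.
by rewrite exprMn -!exprM mulnC.
Qed.

Lemma growth_rateN x a : growth_rate v0 x a -> growth_rate v0 (- x) a.
Proof.
move=> Sx; rewrite -mulN1r -[a]mul1r; apply: (growth_rateM hv0) => //.
have m1 : (-1 : rat) != 0 by rewrite oppr_eq0 oner_eq0.
by have := @growth_rate_alg _ k _ hv0 _ m1; rewrite scaleN1r (avN hv0) (av1 hv0).
Qed.

(* The characteristic polynomial of [x] takes the values [fnorm (j - x)], which are
   bounded; its trace coefficient is recovered by interpolation at [0 .. n]. *)
Lemma ftrace_bounded : exists2 T, 0 <= T & forall x, growth_rate v0 x 1 -> v0 (ftrace x) <= T.
Proof.
pose a : 'rV[rat]_n.+1 := \row_j j%:R.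
pose V := Vandermonde n.+1 a.
have uV : V \in unitmx.
  rewrite unitmxE det_Vandermonde unitfE; apply/prodf_neq0 => i _.
  apply/prodf_neq0 => j ij; rewrite !mxE subr_eq0 eqr_nat.
  by apply/eqP => e; rewrite e ltnn in ij.
have n0 : (0 < n)%N by exact: (adim_gt0 {:k}%AS).
have hn : (n.-1 < n.+1)%N by lia.
(* The base [v0 j%:R + 1 + 1] is a growth rate of [j - x]: [v0 j%:R + 1] lies strictly above the
   spectral radius of [j], and the last 1 is the rate of [x]. The other factors come from inverting
   the Vandermonde matrix. *)
pose T := \sum_(j < n.+1) (v0 j%:R + 1 + 1) ^+ n * v0 (invmx V j (Ordinal hn)).
have T0 : 0 <= T.
  apply: sumr_ge0 => j _.
  by rewrite mulr_ge0 ?(av_ge0 hv0) // exprn_ge0 // !addr_ge0 // (av_ge0 hv0).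
exists T => // x Sx; pose chi := char_poly (mulmat x).
pose c : 'rV[rat]_n.+1 := \row_j chi`_j.
pose vals : 'rV[rat]_n.+1 := \row_j chi.[j%:R].
have cV : c *m V = vals.
  apply/rowP => j; rewrite !mxE (@horner_coef_wide _ n.+1) ?size_char_poly //.
  by apply: eq_bigr => i _; rewrite !mxE.
have ec : c = vals *m invmx V by rewrite -cV mulmxK.
have -> : v0 (ftrace x) = v0 (chi`_n.-1).
  by rewrite /chi char_poly_trace // (avN hv0).
have -> : chi`_n.-1 = c 0 (Ordinal hn) by rewrite mxE.
rewrite ec mxE (le_trans (av_sum hv0 _ _ _)) // ler_sum // => j _.
rewrite (avM hv0) ler_wpM2r ?(av_ge0 hv0) // mxE horner_char_poly_det.
have -> : (j%:R)%:M - mulmat x = mulmat (j%:R%:A - x).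
  by rewrite mulmatD mulmatZ mulmat1 scalemx1 -[- x]scaleN1r mulmatZ scaleN1r.
apply: fnorm_le_growth_rate; apply: (growth_rateD hv0); last exact: growth_rateN.
apply: (rho_lt hv0); rewrite (le_lt_trans (rho_alg k hv0 _)) //.
by rewrite ltrDl.
Qed.

Variable pi : rat.
Hypothesis hpi : 1 < v0 pi.

(** Rational scalars reach every size up to the factor [v0 pi]; this takes the place of scaling by a
    real number. Multiplying [r] by a power of [v0 pi] first makes the search for the exponent run
    over naturals. *)
Lemma av_scale (r : R) : 0 < r -> exists l : rat, r < v0 l /\ v0 l <= v0 pi * r.
Proof.
move=> r0; set B := v0 pi; have B0 : 0 < B by rewrite (lt_trans ltr01).
have [M hM] := expr_unbounded (r^-1) hpi.
pose s := r * B ^+ M.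
have s1 : 1 < s by rewrite /s mulrC -ltr_pdivrMr // mul1r.
have exN : exists N, s < B ^+ N by exact: expr_unbounded.
have [N hN Nmin] := ex_minnP exN.
case: N hN Nmin => [|N] hN Nmin.
  by move: hN; rewrite expr0 ltNge ltW.
exists (pi ^+ N.+1 / pi ^+ M).
rewrite (avM hv0) (avV hv0) !(avX hv0) -/B.
have BM : 0 < B ^+ M by rewrite exprn_gt0.
rewrite ltr_pdivlMr // ler_pdivrMr // -mulrA; split => //.
rewrite exprS ler_pM2l // leNgt; apply/negP => h.
by have := Nmin N h; rewrite ltnn.
Qed.

(** Divide [x] by a rational slightly larger than [rho v0 x]: the quotient has growth rate 1 and
    [ftrace_bounded] applies. The factor [v0 pi] is the loss in [av_scale]. *)
Lemma ftrace_le_rho : exists2 T, 0 <= T & forall x, v0 (ftrace x) <= T * rho v0 x.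
Proof.
have [T T0 hT] := ftrace_bounded; exists (T * v0 pi).
  by rewrite mulr_ge0 // (av_ge0 hv0).
move=> x; have [->|x0] := eqVneq x 0.
  rewrite -(scale0r (0 : k)) ftraceZ mul0r (av0 hv0).
  by rewrite !mulr_ge0 ?(rho_ge0 hv0) ?(av_ge0 hv0).
have r0 := sq_gt0 (sqnorm_rho k hv0) x0.
have [l [l1 l2]] := av_scale r0.
have l0 : l != 0.
  by apply/eqP => e; move: l1; rewrite e (av0 hv0) ltNge ltW.
have vl0 := av_gt0 hv0 l0.
have Sl : growth_rate v0 (l^-1 *: x) 1.
  apply: (rho_lt hv0); rewrite -mulr_algl (le_lt_trans (rhoM hv0 _ _)) //.
  apply: (@le_lt_trans _ _ ((v0 l)^-1 * rho v0 x)).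
    by rewrite ler_wpM2r ?(rho_ge0 hv0) // -(avV hv0) (rho_alg k hv0).
  by rewrite mulrC ltr_pdivrMr // mul1r.
have := hT _ Sl; rewrite ftraceZ (avM hv0) (avV hv0) mulrC ler_pdivrMr // => h.
by rewrite (le_trans h) // -mulrA ler_wpM2l.
Qed.

Lemma nrm_le_rho : exists2 K, 0 < K & forall x, nrm x <= K * rho v0 x.
Proof.
have [T T0 hT] := ftrace_le_rho.
pose G := invmx (trace_gram k).
pose K := \sum_(i < n) \sum_(j < n) T * rho v0 (bas j) * v0 (G j i).
have K0 : 0 <= K.
  apply: sumr_ge0 => i _; apply: sumr_ge0 => j _.
  by rewrite !mulr_ge0 ?(rho_ge0 hv0) ?(av_ge0 hv0).
exists (1 + K) => [|x]; first by rewrite ltr_pwDl.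
apply: (@le_trans _ _ (K * rho v0 x)); last first.
  by rewrite ler_wpM2r ?(rho_ge0 hv0) // lerDr.
rewrite /K mulr_suml; apply: ler_sum => i _; rewrite mulr_suml.
have -> : crd i x = ((\row_j ftrace (x * bas j)) *m G) 0 i.
  by rewrite -crd_trace_gram mulmxK ?trace_gram_unit // mxE.
rewrite mxE (le_trans (av_sum hv0 _ _ _)) // ler_sum // => j _.
rewrite (avM hv0) mulrAC ler_wpM2r ?(av_ge0 hv0) // mxE (le_trans (hT _)) //.
by rewrite -mulrA ler_wpM2l // mulrC (rhoM hv0).
Qed.

Lemma nrm_le_ext : exists2 K, 0 < K &
  forall x, x != 0 -> exists2 v, @ext_av R k v0 v & nrm x <= K * v x.
Proof.
have [K K0 hK] := nrm_le_rho; exists K => // x x0.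
by have [v hv e] := ext_spectral hv0 x0; exists v => //; rewrite e.
Qed.
End Bounds.

(** * Weak approximation *)

Definition eventually_nat (P : nat -> Prop) := exists N, forall m, (N <= m)%N -> P m.

Lemma eventually_nat_and P Q :
  eventually_nat P -> eventually_nat Q -> eventually_nat (fun m => P m /\ Q m).
Proof.
move=> [N hN] [M hM]; exists (maxn N M) => m; rewrite geq_max => /andP[? ?].
by split; [apply: hN|apply: hM].
Qed.

Lemma eventually_nat_seq (I : eqType) (s : seq I) (P : I -> nat -> Prop) :
  (forall i, i \in s -> eventually_nat (P i)) ->
  eventually_nat (fun m => forall i, i \in s -> P i m).
Proof.
elim: s => [|i s IH] h; first by exists 0%N.
have [|N hN] := IH; first by move=> j js; apply: h; rewrite inE js orbT.
have [|M hM] := h i; first by rewrite inE eqxx.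
exists (maxn N M) => m; rewrite geq_max => /andP[h1 h2] j; rewrite inE.
by case/predU1P => [->|]; [apply: hM|apply: hN].
Qed.

Lemma eventually_nat_ex P : eventually_nat P -> exists m, P m.
Proof. by case=> N h; exists N; apply: h. Qed.

Lemma exists_pos_lb (R : realType) (I : finType) (c : I -> R) :
  (forall i, 0 < c i) -> exists2 c0, 0 < c0 & forall i, c0 <= c i.
Proof.
move=> hc; pose S := 1 + \sum_i (c i)^-1.
have S0 : 0 < S by rewrite ltr_pwDl // sumr_ge0 // => i _; rewrite invr_ge0 ltW.
exists S^-1; rewrite ?invr_gt0 // => i.
rewrite -[leRHS]invrK lef_pV2 ?posrE ?invr_gt0 // /S (bigD1 i) //= addrCA lerDl.
by rewrite addr_ge0 // sumr_ge0 // => j _; rewrite invr_ge0 ltW.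
Qed.

Section Approximation.
Variables (R : realType) (K : fieldType) (v : K -> R).
Hypothesis hv : abs_value v.

Lemma approx_one (x : K) d : 1 < v x -> 0 < d ->
  eventually_nat (fun m => v (x ^+ m / (1 + x ^+ m) - 1) < d).
Proof.
move=> x1 d0; have [N hN] := expr_unbounded (1 + d^-1) x1.
exists N => m Nm.
have hm : 1 + d^-1 < v x ^+ m.
  by rewrite (lt_le_trans hN) // ler_weXn2l // ltW.
have h1 : d^-1 < v (1 + x ^+ m).
  have := avB hv (1 + x ^+ m) 1; rewrite addrC addKr (av1 hv) (avX hv); lra.
have d1 : 0 < d^-1 by rewrite invr_gt0.
have n0 : 1 + x ^+ m != 0.
  by apply/eqP => e; move: h1; rewrite e (av0 hv) ltNge ltW.
have -> : x ^+ m / (1 + x ^+ m) - 1 = - (1 + x ^+ m)^-1.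
  by move: (x ^+ m) n0 => y n0; field.
rewrite (avN hv) (avV hv) -[ltRHS]invrK ltf_pV2 ?posrE //.
exact: lt_trans h1.
Qed.

Lemma approx_zero (x : K) d : v x < 1 -> 0 < d ->
  eventually_nat (fun m => v (x ^+ m / (1 + x ^+ m)) < d).
Proof.
move=> x1 d0.
have half0 : 0 < 1 / 2 :> R by rewrite divr_gt0.
have [N1 h1] := expr_small (av_ge0 hv x) x1 half0.
have [|N2 h2] := @expr_small _ _ (d / 2) (av_ge0 hv x) x1; first by rewrite divr_gt0.
exists (maxn N1 N2) => m; rewrite geq_max => /andP[m1 m2].
have {}h1 := h1 _ m1; have {}h2 := h2 _ m2.
rewrite (avM hv) (avV hv) (avX hv).
have h3 : 1 / 2 < v (1 + x ^+ m).
  have := avB hv (1 + x ^+ m) (x ^+ m); rewrite addrK (av1 hv) (avX hv).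
  by move: h1; rewrite -!(avX hv); lra.
rewrite ltr_pdivrMr ?(lt_trans half0 h3) //.
rewrite (lt_trans h2) //; have : d / 2 = d * (1 / 2) by field.
by move->; rewrite ltr_pM2l.
Qed.
End Approximation.

Section Local.
Variables (R : realType) (k : fieldExtType rat) (v0 : rat -> R).
Hypothesis hv0 : abs_value v0.
Variable pi : rat.
Hypothesis hpi : 1 < v0 pi.
Notation n := (\dim {:k}).
Implicit Types x y z : k.
Notation nrm := (nrm v0).
Notation ext := (@ext_av R k v0).

Lemma ext_abs v : ext v -> abs_value v. Proof. by case. Qed.

Lemma ext_Z v q x : ext v -> v (q *: x) = v0 q * v x.
Proof. by case=> hv h; rewrite -mulr_algl (avM hv) -ratr_alg h. Qed.

(** If [w x < v x], a power of [x] widens the ratio beyond [v0 pi], so that a rational fits between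
    the two values. Both extensions agree on it, and dividing by it separates them around 1. In the
    opposite case [x^-1] is used. *)
Lemma ext_separate v w : ext v -> ext w -> v <> w -> exists y, 1 < v y /\ w y < 1.
Proof.
move=> ev_ ew vw.
have key x : w x < v x -> exists y, 1 < v y /\ w y < 1.
  move=> wvx.
  have x0 : x != 0.
    by apply: contraTneq wvx => ->; rewrite (av0 (ext_abs ev_)) (av0 (ext_abs ew)) ltxx.
  have wx := av_gt0 (ext_abs ew) x0.
  have [|N hN] := @expr_unbounded _ (v x / w x) (v0 pi).
    by rewrite ltr_pdivlMr ?mul1r.
  have wN : 0 < w x ^+ N by rewrite exprn_gt0.
  have [l [l1 l2]] := av_scale hv0 hpi wN.
  have l0 : 0 < v0 l by exact: lt_trans l1.
  exists (l^-1 *: x ^+ N); rewrite !ext_Z // (avV hv0).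
  rewrite (avX (ext_abs ev_)) (avX (ext_abs ew)) ![_^-1 * _]mulrC.
  rewrite ltr_pdivlMr // mul1r ltr_pdivrMr // mul1r; split => //.
  by rewrite (le_lt_trans l2) // -ltr_pdivlMr // -expr_div_n.
have [x hx] : exists x, v x != w x.
  apply: contrapT => h; apply: vw; apply/funext => x; apply: contrapT => /eqP e.
  by apply: h; exists x.
move: hx; rewrite neq_lt => /orP[hx|]; last exact: key.
apply: (key x^-1).
have x0 : x != 0.
  by apply: contraTneq hx => ->; rewrite (av0 (ext_abs ev_)) (av0 (ext_abs ew)) ltxx.
rewrite (avV (ext_abs ev_)) (avV (ext_abs ew)) ltf_pV2 ?posrE //.
  exact: (av_gt0 (ext_abs ew)).
exact: (av_gt0 (ext_abs ev_)).
Qed.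

(** The Artin-Whaples induction: [x] separates [v] from the tail, [y] separates it from the head. If
    [x] fails at the head, it enters through [x ^+ m / (1 + x ^+ m)] or [x ^+ m], according to
    whether its value there exceeds 1 or equals 1, and is multiplied by [y]. *)
Lemma ext_separate_seq (I : eqType) (s : seq I) (W : I -> k -> R) v :
  ext v -> (forall i, i \in s -> ext (W i) /\ v <> W i) ->
  exists x, 1 < v x /\ forall i, i \in s -> W i x < 1.
Proof.
move=> hv; have av := ext_abs hv; elim: s => [|i0 s IH] h.
  exists pi%:A; split => //; rewrite ext_Z // (av1 av) mulr1 //.
have [|x [x1 xs]] := IH; first by move=> i si; apply: h; rewrite inE si orbT.
have [|hw vw] := h i0; first by rewrite inE eqxx.
have aw := ext_abs hw.
have [y [y1 y2]] := ext_separate hv hw vw.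
have hs i : i \in s -> abs_value (W i).
  by move=> si; have [|/ext_abs] := h i; first by rewrite inE si orbT.
have [xl|xg|xe] := ltgtP (W i0 x) 1.
- exists x; split => // i; rewrite inE => /predU1P[->//|]; exact: xs.
- have v1 : 0 < v y - 1 by rewrite subr_gt0.
  have vy : 0 < v y by rewrite (lt_trans ltr01).
  have w1 : 0 < 1 - W i0 y by rewrite subr_gt0.
  have w0 := av_ge0 aw y.
  (* The tolerances are chosen for the product with [y]: at [v] the factor stays above [1 / v y]; at
     the head it is below [2 - W i0 y], and t(2 - t) < 1 for t < 1; on the tail it is below
     [(1 + W i y)^-1]. *)
  have e1 := @approx_one _ _ _ av x ((v y - 1) / v y) x1 (divr_gt0 v1 vy).
  have e2 := @approx_one _ _ _ aw x (1 - W i0 y) xg w1.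
  have e3 : eventually_nat (fun m => forall i, i \in s ->
      W i (x ^+ m / (1 + x ^+ m)) < (1 + W i y)^-1).
    apply: eventually_nat_seq => i si; apply: (approx_zero (hs i si)); first exact: xs.
    by rewrite invr_gt0 ltr_pwDl // (av_ge0 (hs i si)).
  have [m [h1 [h2 h3]]] := eventually_nat_ex (eventually_nat_and e1 (eventually_nat_and e2 e3)).
  exists (x ^+ m / (1 + x ^+ m) * y); split.
    rewrite (avM av); set e := _ / _ in h1 *.
    have := avB av e (e - 1); rewrite opprB addrC subrK (av1 av) => h4.
    have h5 : 1 / v y < v e.
      have : 1 / v y = 1 - (v y - 1) / v y by field; rewrite gt_eqF.
      lra.
    by move: h5; rewrite ltr_pdivrMr.
  move=> i; rewrite inE => /predU1P[->|si].
    rewrite (avM aw); set e := _ / _ in h2 *.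
    have h4 := avD aw (e - 1) 1; rewrite subrK (av1 aw) in h4.
    nra.
  have w3 := av_ge0 (hs i si) y; rewrite (avM (hs i si)).
  move: (h3 i si) (av_ge0 (hs i si) (x ^+ m / (1 + x ^+ m))).
  move: (W i (x ^+ m / (1 + x ^+ m))) => e he e0.
  have d0 : 0 < 1 + W i y by rewrite ltr_pwDl.
  have : e * (1 + W i y) < 1 by rewrite -ltr_pdivlMr // div1r.
  have [e00|e00] := eqVneq e 0; first by rewrite e00 !mul0r.
  have : 0 < e by rewrite lt0r e00.
  lra.
have e3 : eventually_nat (fun m => forall i, i \in s -> W i x ^+ m < (1 + W i y)^-1).
  apply: eventually_nat_seq => i si; apply: expr_small; first exact: (av_ge0 (hs i si)).
    exact: xs.
  by rewrite invr_gt0 ltr_pwDl // (av_ge0 (hs i si)).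
have [m hm] := eventually_nat_ex e3; exists (x ^+ m * y); split.
  rewrite (avM av) (avX av) (lt_le_trans y1) // ler_peMl ?exprn_ege1 // ?ltW //.
  by rewrite (lt_trans ltr01).
move=> i; rewrite inE => /predU1P[->|si].
  by rewrite (avM aw) (avX aw) xe expr1n mul1r.
have w3 := av_ge0 (hs i si) y.
have d0 : 0 < 1 + W i y by rewrite ltr_pwDl.
have := hm i si; rewrite -div1r ltr_pdivlMr // (avM (hs i si)) (avX (hs i si)).
have : 0 <= W i x ^+ m by rewrite exprn_ge0 // (av_ge0 (hs i si)).
by rewrite le_eqVlt => /predU1P[<-|]; rewrite ?mul0r //; lra.
Qed.

Section Family.
Variables (r : nat) (v : 'I_r -> k -> R).
Hypothesis v_ext : forall i, ext (v i).
Hypothesis v_inj : injective v.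
Let va i := ext_abs (v_ext i).

Lemma approx_idempotents d : 0 < d -> exists e : 'I_r -> k,
  forall i, v i (1 - e i) < d /\ forall j, j != i -> v j (e i) < d.
Proof.
move=> d0; suff /choice : forall i, exists y, v i (1 - y) < d /\
  forall j, j != i -> v j y < d.
  by move=> [e he]; exists e => i; exact: he.
move=> i; have [|x [x1 xs]] := @ext_separate_seq _ [seq j <- enum 'I_r | j != i] v (v i)
    (v_ext i).
  move=> j; rewrite mem_filter => /andP[ji _]; split => // /v_inj e.
  by rewrite e eqxx in ji.
have e1 := approx_one (va i) x1 d0.
have e2 : eventually_nat (fun m => forall j, j \in [seq j <- enum 'I_r | j != i] ->
    v j (x ^+ m / (1 + x ^+ m)) < d).
  by apply: eventually_nat_seq => j js; apply: approx_zero => //; apply: xs.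
have [m [h1 h2]] := eventually_nat_ex (eventually_nat_and e1 e2); exists (x ^+ m / (1 + x ^+ m)).
split; first by rewrite (avBC (va i)).
by move=> j ji; apply: h2; rewrite mem_filter ji mem_enum.
Qed.

Variables (T : finType) (pl : T -> 'I_r) (a : T -> k) (c : R).
Hypothesis c0 : 0 < c.
Hypothesis a_indep : forall (q : T -> rat) t,
  c * v0 (q t) <= v (pl t) (\sum_(t' | pl t' == pl t) q t' *: a t').

Definition av_total : R := 1 + \sum_i \sum_t v i (a t).
Notation S := av_total.

Lemma av_total_gt0 : 0 < S.
Proof.
rewrite /av_total ltr_pwDl //; apply: sumr_ge0 => i _; apply: sumr_ge0 => t _.
exact: (av_ge0 (va i)).
Qed.

Lemma av_sum_le_total i : \sum_t v i (a t) <= S.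
Proof.
rewrite /av_total (bigD1 i) //= addrCA lerDl addr_ge0 // sumr_ge0 // => j _.
by apply: sumr_ge0 => t _; exact: (av_ge0 (va j)).
Qed.

(** Multiplying each [a t] by the approximate idempotent of its place merges the local families into
    one family in [k], which at every place is close to the block belonging to that place. *)
Lemma twisted_sum_le (e : 'I_r -> k) d (q : T -> rat) M i :
  (forall i, v i (1 - e i) < d /\ forall j, j != i -> v j (e i) < d) ->
  (forall t, v0 (q t) <= M) -> 0 < d -> 0 <= M ->
  v i (\sum_(t | pl t == i) q t *: a t - \sum_t q t *: (e (pl t) * a t))
    <= M * d * S.
Proof.
move=> he hM d0 M0; rewrite [X in _ - X](bigID (fun t => pl t == i)) /= opprD addrA.
rewrite -sumrB (le_trans (avB (va i) _ _)) //.
apply: (@le_trans _ _ (M * d * \sum_t v i (a t))); last first.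
  by rewrite ler_wpM2l ?av_sum_le_total // mulr_ge0 // ltW.
rewrite mulr_sumr [leRHS](bigID (fun t => pl t == i)) /=.
apply: lerD; rewrite (le_trans (av_sum (va i) _ _ _)) //; apply: ler_sum => t ht.
  rewrite -scalerBr ext_Z // -mulrA (eqP ht).
  rewrite ler_pM ?(av_ge0 hv0) ?(av_ge0 (va i)) //.
  have -> : a t - e i * a t = (1 - e i) * a t by ring.
  by rewrite (avM (va i)) ler_wpM2r ?(av_ge0 (va i)) // ltW //; case: (he i).
rewrite ext_Z // -mulrA ler_pM ?(av_ge0 hv0) ?(av_ge0 (va i)) //.
rewrite (avM (va i)) ler_wpM2r ?(av_ge0 (va i)) // ltW //.
by case: (he (pl t)) => _; apply; rewrite eq_sym.
Qed.

(** Bounds the total of the local dimensions by the degree of [k]: the twisted family is independent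
    over the rationals. In a vanishing combination, look at the largest coefficient; the choice of
    [d] keeps the error at half of the lower bound [c * v0 (q tm)], so this coefficient is 0. *)
Lemma indep_card : (#|T| <= n)%N.
Proof.
have d0 : 0 < c / (2 * S) by rewrite divr_gt0 // mulr_gt0 // av_total_gt0.
have [e he] := approx_idempotents d0.
pose z t := e (pl t) * a t.
have inj (q : T -> rat) : \sum_t q t *: z t = 0 -> forall t, q t = 0.
  move=> hq t0; pose tm := [arg max_(t > t0) v0 (q t)]%O.
  have hM t : v0 (q t) <= v0 (q tm).
    by rewrite /tm; case: arg_maxP => // t1 _ h; apply: h.
  have M0 := av_ge0 hv0 (q tm).
  have := twisted_sum_le (pl tm) he hM d0 M0; rewrite hq subr0.
  move/(le_trans (a_indep q tm)).
  have -> : v0 (q tm) * (c / (2 * S)) * S = c * v0 (q tm) / 2.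
    by field; rewrite gt_eqF // av_total_gt0.
  move=> h; have M1 : v0 (q tm) <= 0.
    by rewrite -(ler_pM2l c0) mulr0; lra.
  apply/eqP/negPn/negP => /(av_gt0 hv0); rewrite ltNge; case/negP.
  exact: le_trans M1.
pose B : 'M[rat]_(#|T|, n) := \matrix_(t, s) crd s (z (enum_val t)).
suff : row_free B by rewrite /row_free => /eqP <-; exact: rank_leq_col.
rewrite -kermx_eq0; apply/rowV0P => u /sub_kermxP uB.
apply/rowP => t; rewrite mxE -(enum_valK t).
apply: (inj (fun t => u 0 (enum_rank t))).
rewrite [LHS]crd_sum big1 // => s _.
have /rowP/(_ s) := uB; rewrite !mxE => e0.
rewrite crd_linsum (reindex (@enum_val _ T)) /=; last first.
  by apply: onW_bij; exact: enum_val_bij.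
rewrite (_ : \sum_j _ = 0) ?scale0r // -[RHS]e0; apply: eq_bigr => j _.
by rewrite mxE crdZ enum_valK.
Qed.
End Family.
End Local.

(** * Local bound for the norm *)

Section DetBounds.
Variables (R : realType) (v0 : rat -> R).
Hypothesis hv0 : abs_value v0.

Lemma av_prod_diff (I : Type) (s : seq I) (x y : I -> rat) (L : R) (eta : R) :
  1 <= L -> 0 <= eta ->
  (forall i, v0 (x i) <= L) -> (forall i, v0 (y i) <= L) ->
  (forall i, v0 (x i - y i) <= eta) ->
  v0 (\prod_(i <- s) x i - \prod_(i <- s) y i) <= (size s)%:R * L ^+ size s * eta.
Proof.
move=> L1 e0 hx hy hxy; have L0 : 0 <= L by rewrite (le_trans ler01).
elim: s => [|i s IH]; first by rewrite !big_nil subrr (av0 hv0) !mul0r.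
rewrite !big_cons.
set X := \prod_(j <- s) x j in IH *; set Y := \prod_(j <- s) y j in IH *.
have -> : x i * X - y i * Y = x i * (X - Y) + (x i - y i) * Y by ring.
rewrite (le_trans (avD hv0 _ _)) // !(avM hv0) /=.
have hY : v0 Y <= L ^+ size s.
  rewrite /Y (av_prod hv0); elim: (s) => [|j t IHt]; first by rewrite big_nil expr0.
  by rewrite big_cons exprS ler_pM ?prodr_ge0 // ?(av_ge0 hv0) // => ? _;
     exact: (av_ge0 hv0).
have -> : (size s).+1%:R * L ^+ (size s).+1 * eta
    = L * ((size s)%:R * L ^+ size s * eta) + eta * (L * L ^+ size s).
  by rewrite -natr1 exprS; ring.
apply: lerD; first by rewrite ler_pM ?(av_ge0 hv0).
rewrite ler_pM ?(av_ge0 hv0) // (le_trans hY) //.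
by rewrite ler_peMl // exprn_ge0.
Qed.

Lemma av_det_diff (m : nat) (A : 'M[rat]_m) :
  exists2 D, 0 <= D & forall (B : 'M[rat]_m) eta, 0 <= eta -> eta <= 1 ->
   (forall i j, v0 (A i j - B i j) <= eta) -> v0 (\det A - \det B) <= D * eta.
Proof.
pose L := 2 + \sum_i \sum_j v0 (A i j).
have S0 : 0 <= \sum_i \sum_j v0 (A i j).
  by apply: sumr_ge0 => i _; apply: sumr_ge0 => j _; apply: (av_ge0 hv0).
have L1 : 1 <= L by rewrite /L; lra.
have L0 : 0 <= L by rewrite (le_trans ler01).
have hA i j : v0 (A i j) <= L - 1.
  suff : v0 (A i j) <= \sum_i \sum_j v0 (A i j) by rewrite /L; lra.
  rewrite (bigD1 i) //= (bigD1 j) //= -addrA lerDl addr_ge0 //.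
    by apply: sumr_ge0 => j' _; apply: (av_ge0 hv0).
  by apply: sumr_ge0 => i' _; apply: sumr_ge0 => j' _; apply: (av_ge0 hv0).
exists (\sum_(s : 'S_m) m%:R * L ^+ m) => [|B eta e0 e1 hAB].
  by apply: sumr_ge0 => s _; rewrite mulr_ge0 // exprn_ge0.
have hB i j : v0 (B i j) <= L.
  have := avB hv0 (A i j) (A i j - B i j); rewrite opprB addrC subrK.
  have := hA i j; have := hAB i j; lra.
rewrite /determinant -sumrB mulr_suml (le_trans (av_sum hv0 _ _ _)) //.
apply: ler_sum => s _; rewrite -mulrBr (av_sign hv0).
have := @av_prod_diff 'I_m (index_enum 'I_m) (fun i => A i (s i)) (fun i => B i (s i))
   L eta L1 e0.
have -> : size (index_enum 'I_m) = m by rewrite -[RHS]card_ord cardT enumT.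
apply => // i; have := hA i (s i); lra.
Qed.

(** For [p = m] the determinant factors; for [p < m] the product is singular. The constant is fixed
    before [Q], [B] and [w], as these will vary with the element whose norm is estimated. *)
Lemma av_det_mulmx_le (m p : nat) (C1 C2 : R) : (p <= m)%N -> 0 <= C1 -> 0 <= C2 ->
  exists2 K, 0 <= K & forall (Q : 'M[rat]_(m, p)) (B : 'M[rat]_(p, m)) (w : 'I_p -> R),
    (forall t, 0 <= w t) ->
    (forall i t, v0 (Q i t) <= C1 * w t) -> (forall t s, v0 (B t s) <= C2) ->
    v0 (\det (Q *m B)) <= K * \prod_t w t.
Proof.
move=> pm C10 C20; rewrite leq_eqVlt in pm; case/predU1P: pm => [e|pm].
  subst p; exists (m`!%:R * C1 ^+ m * (m`!%:R * C2 ^+ m)).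
    by rewrite !mulr_ge0 ?exprn_ge0.
  move=> Q B w w0 hQ hB; rewrite det_mulmx (avM hv0).
  have := av_det_le hv0 hQ; rewrite big_split /= prodr_const card_ord => h1.
  have := av_det_le hv0 (fun t s => hB t s); rewrite prodr_const card_ord => h2.
  rewrite mulrAC ler_pM ?(av_ge0 hv0) //.
  by rewrite -mulrA.
exists 0 => // Q B w _ _ _; rewrite mul0r.
suff -> : \det (Q *m B) = 0 by rewrite (av0 hv0).
apply/eqP/negPn/negP => h.
have : row_free (Q *m B) by rewrite row_free_unit unitmxE unitfE.
rewrite /row_free => /eqP e; have := mulmx_max_rank Q B; rewrite e.
by rewrite leqNgt pm.
Qed.
End DetBounds.

Section LocalNorm.
Variables (R : realType) (k : fieldExtType rat) (v0 : rat -> R).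
Hypothesis hv0 : abs_value v0.
Variable pi : rat.
Hypothesis hpi : 1 < v0 pi.
Notation n := (\dim {:k}).
Implicit Types x y z : k.
Notation nrm := (nrm v0).
Notation ext := (@ext_av R k v0).

Section Family.
Variables (r : nat) (v : 'I_r -> k -> R).
Hypothesis v_ext : forall i, ext (v i).
Hypothesis v_inj : injective v.
Hypothesis v_surj : forall w, ext w -> exists i, w = v i.
Let va i := ext_abs (v_ext i).

Variables (T : finType) (pl : T -> 'I_r) (a : T -> k) (c : R).
Hypothesis c0 : 0 < c.
Hypothesis a_indep : forall (q : T -> rat) t,
  c * v0 (q t) <= v (pl t) (\sum_(t' | pl t' == pl t) q t' *: a t').
Hypothesis a_dense : forall i x eps, 0 < eps ->
  exists q : T -> rat, v i (x - \sum_(t | pl t == i) q t *: a t) < eps.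

Let S := av_total v a.
Let S0 : 0 < S. Proof. exact: av_total_gt0. Qed.

Lemma ext_nrm_le : exists2 K, 0 < K & forall y M, 0 <= M ->
  (forall i, v i y <= M) -> nrm y <= K * M.
Proof.
have [K K0 hK] := nrm_le_ext k hv0 hpi; exists K => // y M M0 hM.
have [->|y0] := eqVneq y 0; first by rewrite (nrm0 _ hv0) mulr_ge0 // ltW.
have [w /v_surj[i ->] h] := hK y y0.
by rewrite (le_trans h) // ler_pM2l.
Qed.

(** The matrix of multiplication by [x] is close to a product [Q *m B]: [Q] holds local coordinates
    of the [x * bas j], of size [v (pl t) x], and [B] holds coordinates of the twisted family, of
    bounded size. Continuity of the determinant transfers the bound for [Q *m B]. *)
Lemma fnorm_le_prod_cst : exists2 K, 0 <= K &
  forall x, x != 0 -> v0 (fnorm x) <= K * \prod_t v (pl t) x.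
Proof.
have [K K0 hK] := ext_nrm_le.
pose S' := 1 + \sum_i \sum_(j < n) v i (bas j).
have S'0 : 0 < S'.
  rewrite ltr_pwDl // sumr_ge0 // => i _; apply: sumr_ge0 => j _.
  exact: (av_ge0 (va i)).
have hS' i (j : 'I_n) : v i (bas j) <= S'.
  rewrite /S' (bigD1 i) //= (bigD1 j) //= addrCA -addrA lerDl !addr_ge0 // sumr_ge0 //.
    by move=> i' _; exact: (av_ge0 (va i)).
  by move=> i' _; apply: sumr_ge0 => j' _; exact: (av_ge0 (va i')).
(* Neither constant involves [x]. The 2 in [C1] comes from an approximation of [x * bas j] at most
   doubling its value, the 2 in [C2] from [v i (e j) <= 2]. *)
pose C1 := 2 * S' / c; pose C2 := K * (2 * S).
have C10 : 0 <= C1 by rewrite ltW // divr_gt0 // mulr_gt0.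
have C20 : 0 <= C2 by rewrite ltW // !mulr_gt0.
have Tn : (#|T| <= n)%N := indep_card hv0 hpi v_ext v_inj c0 a_indep.
have [K' K'0 hK'] := av_det_mulmx_le hv0 Tn C10 C20.
exists K' => // x x0.
have [D D0 hD] := av_det_diff hv0 (mulmat x).
apply/ler_addgt0Pr => eps0 eps0_gt0.
pose eta := Num.min 1 (eps0 / (D + 1)).
have D1 : 0 < D + 1 by rewrite ltr_wpDl.
have eta0 : 0 < eta by rewrite lt_min ltr01 divr_gt0.
have eta1 : eta <= 1 by rewrite ge_min lexx.
have etaD : D * eta <= eps0.
  have : eta <= eps0 / (D + 1) by rewrite ge_min lexx orbT.
  rewrite ler_pdivlMr // => h; apply: le_trans h; rewrite mulrC ler_pM2l //.
  by rewrite lerDl.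
(* An error below [e1] is smaller than the value of every [x * bas j] at every place, which is what
   makes the local coordinates proportional to [v (pl t) x]. *)
have [e1 e10 he1] := @exists_pos_lb R ('I_r * 'I_n)%type (fun ij => v ij.1 (x * bas ij.2))
  (fun ij => av_gt0 (va ij.1) (mulf_neq0 x0 (bas_neq0 ij.2))).
pose eps := Num.min e1 (eta / (2 * K)).
have eps_gt0 : 0 < eps by rewrite lt_min e10 divr_gt0 // mulr_gt0.
have eps_e1 : eps <= e1 by rewrite ge_min lexx.
have eps_eta : K * (2 * eps) <= eta.
  have : eps <= eta / (2 * K) by rewrite ge_min lexx orbT.
  rewrite ler_pdivlMr ?mulr_gt0 // => h; apply: le_trans h.
  by rewrite le_eqVlt; apply/orP; left; apply/eqP; ring.
have /choice[q0 hq0] : forall ij : 'I_r * 'I_n, exists q : T -> rat,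
    v ij.1 (x * bas ij.2 - \sum_(t | pl t == ij.1) q t *: a t) < eps.
  by move=> ij; exact: a_dense.
pose q (j : 'I_n) t := q0 (pl t, j) t.
have hq i j : v i (x * bas j - \sum_(t | pl t == i) q j t *: a t) < eps.
  have := hq0 (i, j); rewrite /= (eq_bigr (fun t => q j t *: a t)) // => t /eqP e.
  by rewrite /q e.
have q_le j t : v0 (q j t) <= C1 * v (pl t) x.
  have h1 := a_indep (q j) t; have h2 := hq (pl t) j.
  have h3 := avBC (va (pl t)) (x * bas j) (\sum_(t' | pl t' == pl t) q j t' *: a t').
  have h4 := avD (va (pl t)) (\sum_(t' | pl t' == pl t) q j t' *: a t' - x * bas j)
    (x * bas j); rewrite subrK -h3 in h4.
  have h5 := he1 (pl t, j); rewrite /= in h5.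
  have h6 : v (pl t) (x * bas j) <= S' * v (pl t) x.
    by rewrite (avM (va _)) mulrC ler_wpM2r // (av_ge0 (va _)).
  rewrite /C1 mulrAC ler_pdivlMr // mulrC; lra.
pose M := 1 + \sum_(j < n) \sum_t v0 (q j t).
have M0 : 0 < M.
  rewrite ltr_pwDl // sumr_ge0 // => j _; apply: sumr_ge0 => t _.
  exact: (av_ge0 hv0).
have hM j t : v0 (q j t) <= M.
  rewrite /M (bigD1 j) //= (bigD1 t) //= addrCA -addrA lerDl !addr_ge0 // sumr_ge0 //.
    by move=> i' _; exact: (av_ge0 hv0).
  by move=> i' _; apply: sumr_ge0 => j' _; exact: (av_ge0 hv0).
(* The coefficients [q] are chosen before the idempotents, so their bound [M], which depends on [x],
   can be absorbed into the precision [d]. *)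
pose d := Num.min 1 (eps / (M * S)).
have d0 : 0 < d by rewrite lt_min ltr01 divr_gt0 // mulr_gt0.
have d1 : d <= 1 by rewrite ge_min lexx.
have dM : M * d * S <= eps.
  have : d <= eps / (M * S) by rewrite ge_min lexx orbT.
  by rewrite ler_pdivlMr ?mulr_gt0 // mulrA [d * M]mulrC.
have [e he] := approx_idempotents hv0 hpi v_ext v_inj d0.
pose z t := e (pl t) * a t.
have ve i j : v i (e j) <= 2.
  have [->|ij] := eqVneq i j.
    have [h _] := he j; have := avB (va j) 1 (1 - e j).
    rewrite opprB addrC subrK (av1 (va j)); lra.
  by have [_ /(_ i ij)] := he j; lra.
have nz t : nrm (z t) <= C2.
  apply: hK => [|i]; first by rewrite mulr_ge0 // ltW.
  rewrite (avM (va i)) ler_pM ?(av_ge0 (va i)) //.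
  apply: le_trans (av_sum_le_total v_ext a i).
  by rewrite (bigD1 t) //= lerDl sumr_ge0 // => t' _; exact: (av_ge0 (va i)).
have nE (j : 'I_n) : nrm (x * bas j - \sum_t q j t *: z t) <= eta.
  apply: le_trans eps_eta; apply: hK => [|i]; first by rewrite mulr_ge0 // ltW.
  rewrite (le_trans (av_triangle (va i) _ (\sum_(t | pl t == i) q j t *: a t) _)) //.
  have h1 := hq i j.
  have h2 := twisted_sum_le hv0 v_ext pl a i he (hM j) d0 (ltW M0).
  have h3 := le_trans h2 dM; rewrite mulr_natl mulr2n; apply: lerD => //.
  exact: ltW.
pose Q : 'M[rat]_(n, #|T|) := \matrix_(j, t) q j (enum_val t).
pose B : 'M[rat]_(#|T|, n) := \matrix_(t, s) crd s (z (enum_val t)).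
have QB j s : (Q *m B) j s = crd s (\sum_t q j t *: z t).
  rewrite !mxE crd_linsum (reindex (@enum_val _ T)) /=; last first.
    by apply: onW_bij; exact: enum_val_bij.
  by apply: eq_bigr => t _; rewrite !mxE crdZ.
have hdiff : v0 (fnorm x - \det (Q *m B)) <= D * eta.
  apply: hD => //; first exact: ltW.
  move=> j s; rewrite QB mxE; apply: le_trans (nE j).
  have -> : crd s (x * bas j) - crd s (\sum_t q j t *: z t)
     = crd s (x * bas j - \sum_t q j t *: z t).
    by rewrite crdD -scaleN1r crdZ mulN1r.
  exact: crd_le_nrm.
have := hK' Q B (fun t => v (pl (enum_val t)) x).
have <- : \prod_t v (pl t) x = \prod_(i < #|T|) v (pl (enum_val i)) x.
  by rewrite (reindex (@enum_val _ T)) //; apply: onW_bij; exact: enum_val_bij.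
move=> h.
have {}h : v0 (\det (Q *m B)) <= K' * \prod_t v (pl t) x.
  apply: h => [t|i t|t s]; first exact: (av_ge0 (va _)).
    by rewrite mxE.
  by rewrite mxE (le_trans (crd_le_nrm hv0 _ _)).
have := avD hv0 (fnorm x - \det (Q *m B)) (\det (Q *m B)); rewrite subrK; lra.
Qed.

(* The constant disappears on replacing [x] by its powers. *)
Lemma fnorm_le_prod x : x != 0 -> v0 (fnorm x) <= \prod_t v (pl t) x.
Proof.
move=> x0; have [K K0 hK] := fnorm_le_prod_cst.
apply: (@expr_dominated _ _ _ K); first exact: (av_ge0 hv0).
  by apply: prodr_gt0 => t _; exact: (av_gt0 (va _)).
move=> m; rewrite -(avX hv0) -fnormX (le_trans (hK _ _)) ?expf_neq0 //.
rewrite -prodrXl; under eq_bigr => t _ do rewrite (avX (va _)).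
exact: lexx.
Qed.
End Family.
End LocalNorm.

(** * Local degrees *)

Section LocalDegree.
Variables (R : realType) (k : fieldExtType rat) (v0 : rat -> R).
Hypothesis hv0 : abs_value v0.
Variable pi : rat.
Hypothesis hpi : 1 < v0 pi.
Notation n := (\dim {:k}).
Implicit Types x y z : k.
Notation ext := (@ext_av R k v0).

Lemma indep_over_completionP v m : ext v ->
  indep_over_completion v m <->
  exists (a : 'I_m -> k) (c : R), 0 < c /\
    forall q i, c * v0 (q i) <= v (\sum_i q i *: a i).
Proof.
move=> hv; have va := ext_abs hv; case: (hv) => _ vq.
have E (a : 'I_m -> k) q : \sum_i ratr (q i) * a i = \sum_i q i *: a i.
  by apply: eq_bigr => i _; rewrite ratr_alg mulr_algl.
split=> -[a [c [c0 h]]]; exists a, c; split => // q.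
  move=> i; rewrite -E; apply: le_trans (h q); rewrite ler_pM2l // -vq.
  exact: (le_bigmax _ (fun i => v (ratr (q i)))).
rewrite E mulrC -ler_pdivlMr //; apply/bigmax_leP; split.
  by rewrite divr_ge0 ?(av_ge0 va) // ltW.
by move=> i _; rewrite ler_pdivlMr // mulrC vq.
Qed.

(** [indep_card] with the single element 1 at each place. *)
Lemma ext_inj_card r (v : 'I_r -> k -> R) :
  (forall i, ext (v i)) -> injective v -> (r <= n)%N.
Proof.
move=> hv iv; rewrite -[r](card_ord r).
apply: (@indep_card _ _ _ hv0 _ hpi _ _ hv iv _ id (fun=> 1) 1) => // q t.
by rewrite mul1r big_pred1_eq (ext_Z _ _ (hv t)) (av1 (ext_abs (hv t))) mulr1.
Qed.

Lemma ext_indep_le v m : ext v -> indep_over_completion v m -> (m <= n)%N.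
Proof.
move=> hv /(indep_over_completionP _ hv)[a [c [c0 h]]].
have iv : injective (fun _ : 'I_1 => v) by move=> i j _; rewrite !ord1.
rewrite -[m](card_ord m).
apply: (@indep_card _ _ _ hv0 _ hpi _ _ (fun=> hv) iv _ (fun=> ord0) a c) => //.
Qed.

(** A maximal independent family has dense span: an element at distance at least [eps] from the span
    could be adjoined to it. *)
Lemma local_degree_basis v : ext v ->
  exists (a : 'I_(local_degree v) -> k) (c : R), [/\ 0 < c,
    forall q i, c * v0 (q i) <= v (\sum_i q i *: a i) &
    forall x eps, 0 < eps -> exists q, v (x - \sum_i q i *: a i) < eps].
Proof.
move=> hv; have va := ext_abs hv.
have : indep_over_completion v (local_degree v).
  pose A : pred 'I_n.+1 := fun m => `[< indep_over_completion v m >].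
  have A0 : (0 < #|A|)%N.
    apply/card_gt0P; exists ord0; apply/asboolP/(indep_over_completionP _ hv).
    by exists (fun=> 0), 1; split => // q [].
  have [m mA e] := eq_bigmax_cond (fun m : 'I_n.+1 => m : nat) A0.
  rewrite /local_degree; have -> : (\max_(m < n.+1 | A m) m)%N = m by exact: e.
  exact/asboolP.
set d := local_degree v => hd.
have [a [c [c0 h]]] := (indep_over_completionP _ hv).1 hd.
exists a, c; split => // x eps eps0; apply: contrapT => hno.
have far q : eps <= v (x - \sum_i q i *: a i).
  by rewrite leNgt; apply/negP => hlt; apply: hno; exists q.
(* [local_degree] is a maximum over a bounded range, so [ext_indep_le] has to place [d.+1] in this
   range before maximality is contradicted. *)
suff hd1 : indep_over_completion v d.+1.
  have dn := ext_indep_le hv hd1.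
  have dn1 : (d.+1 < n.+1)%N by [].
  have : (d.+1 <= d)%N.
    apply: (@leq_bigmax_cond _ (fun m : 'I_n.+1 => `[< indep_over_completion v m >])
      (fun m : 'I_n.+1 => m : nat) (Ordinal dn1)); exact/asboolP.
  by rewrite ltnn.
apply/(indep_over_completionP _ hv).
pose a' (j : 'I_d.+1) := if unlift ord0 j is Some i then a i else x.
(* By [far'] the coefficient of [x] is at most the value of the whole sum divided by [eps]; removing
   the term in [x] therefore multiplies the bound by at most [C]. *)
pose C := 1 + v x / eps.
have C0 : 0 < C by rewrite ltr_pwDl // divr_ge0 ?(av_ge0 va) // ltW.
have far' q : eps * v0 (q ord0) <= v (\sum_i q i *: a' i).
  have [e|q0] := eqVneq (q ord0) 0.
    by rewrite e (av0 hv0) mulr0 (av_ge0 va).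
  have -> : \sum_i q i *: a' i =
     q ord0 *: (x - \sum_(i < d) (- q (lift ord0 i) / q ord0) *: a i).
    rewrite big_ord_recl /a' unlift_none scalerBr scaler_sumr; congr (_ + _).
    rewrite -sumrN; apply: eq_bigr => i _; rewrite liftK scalerA -scaleNr.
    by rewrite mulrCA divff // mulr1 opprK.
  by rewrite (ext_Z _ _ hv) mulrC ler_wpM2l ?(av_ge0 hv0).
exists a', (Num.min eps (c / C)); split; first by rewrite lt_min eps0 divr_gt0.
move=> q i; case: (unliftP ord0 i) => [j|] ->; last first.
  apply: le_trans (far' q); rewrite ler_wpM2r ?(av_ge0 hv0) //.
  by rewrite ge_min lexx.
apply: (@le_trans _ _ (c / C * v0 (q (lift ord0 j)))).
  by rewrite ler_wpM2r ?(av_ge0 hv0) // ge_min lexx orbT.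
rewrite mulrAC ler_pdivrMr //.
apply: (le_trans (h (fun j => q (lift ord0 j)) j)).
set Y := \sum_i q i *: a' i.
have -> : \sum_i q (lift ord0 i) *: a i = Y - q ord0 *: x.
  rewrite /Y big_ord_recl /a' unlift_none addrC addKr.
  by apply: eq_bigr => l _; rewrite liftK.
rewrite (le_trans (avB va _ _)) // (ext_Z _ _ hv) mulrDr mulr1 lerD2l.
rewrite mulrA ler_pdivlMr // mulrAC ler_wpM2r ?(av_ge0 va) // mulrC.
exact: far'.
Qed.

Lemma ext_finite : finite_set ext.
Proof.
apply: contrapT => /(@infinite_set_fset _ _ n.+1)[B Bext Bn].
pose w (i : 'I_(size (finmap.enum_fset B))) := nth (fun=> 0) (finmap.enum_fset B) i.
have hw i : ext (w i) by apply: Bext; apply: mem_nth; exact: ltn_ord.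
have iw : injective w.
  move=> i j /eqP; rewrite nth_uniq ?finmap.fset_uniq ?ltn_ord //.
  by move/eqP/val_inj.
by have := ext_inj_card hw iw; rewrite leqNgt Bn.
Qed.

Lemma ln_prodX (I : Type) (s : seq I) (y : I -> R) (d : I -> nat) :
  (forall i, 0 < y i) ->
  ln (\prod_(i <- s) y i ^+ d i) = \sum_(i <- s) (d i)%:R * ln (y i).
Proof.
move=> hy; suff [_ ->] : 0 < \prod_(i <- s) y i ^+ d i /\
  ln (\prod_(i <- s) y i ^+ d i) = \sum_(i <- s) (d i)%:R * ln (y i) by [].
elim/big_rec2: _ => [|i y1 y2 _ [h1 h2]]; first by rewrite ln1.
have h3 : 0 < y i ^+ d i by rewrite exprn_gt0.
by split; [exact: mulr_gt0|rewrite lnM ?posrE // h2 lnXn // mulr_natl].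
Qed.

(** [fnorm_le_prod] for the disjoint union of the local bases, indexed by a sigma type: its fibre
    over [i] has [local_degree (v i)] elements, which produces the exponents. *)
Lemma ext_sum_ge x : x != 0 ->
  ln (v0 (fnorm x)) <= \sum_(v \in ext) (local_degree v)%:R * ln (v x).
Proof.
move=> x0; have [s0 es0] := (finite_seqP ext).1 ext_finite.
pose s := undup s0; have us : uniq s by exact: undup_uniq.
have es : ext = [set` s]%classic.
  by rewrite es0; apply/seteqP; split => w; rewrite /= mem_undup.
rewrite es -fsbig_seq //.
pose r := size s; pose v (i : 'I_r) := nth (fun=> 0) s i.
have hv i : ext (v i) by rewrite es /=; apply: mem_nth; exact: ltn_ord.
have iv : injective v by move=> i j /eqP; rewrite nth_uniq // => /eqP/val_inj.
have sv w : ext w -> exists i, w = v i.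
  rewrite es /= => ws; have wi : (index w s < r)%N by rewrite index_mem.
  by exists (Ordinal wi); rewrite /v /= nth_index.
pose J i : finType := 'I_(local_degree (v i)).
pose hb i := cid (local_degree_basis (hv i)); pose a i : J i -> k := projT1 (hb i).
pose hc i := cid (projT2 (hb i)); pose c i : R := projT1 (hc i).
have hac i : [/\ 0 < c i, forall q l, c i * v0 (q l) <= v i (\sum_l q l *: a i l) &
    forall y eps, 0 < eps -> exists q, v i (y - \sum_l q l *: a i l) < eps].
  exact: (projT2 (hc i)).
have [c1 c10 hc1] := @exists_pos_lb R 'I_r c (fun i => let: And3 h _ _ := hac i in h).
pose T : finType := {i : 'I_r & J i}.
pose at_ (t : T) := a (tag t) (tagged t).
have sumE (q : T -> rat) i :
    \sum_(t : T | tag t == i) q t *: at_ t = \sum_l q (Tagged J l) *: a i l.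
  have := @sig_big_dep k 0 +%R 'I_r J (fun i' => i' == i) (fun _ => predT)
    (fun i' l => q (Tagged J l) *: a i' l).
  rewrite big_pred1_eq => ->; apply: eq_big => [t|[i' l] _] //.
  by rewrite andbT.
have indep (q : T -> rat) t :
    c1 * v0 (q t) <= v (tag t) (\sum_(t' | tag t' == tag t) q t' *: at_ t').
  rewrite sumE; have [_ h _] := hac (tag t).
  have := h (fun l => q (Tagged J l)) (tagged t); case: t {h} => i l /=.
  by apply: le_trans; rewrite ler_wpM2r ?(av_ge0 hv0).
have dense i y eps : 0 < eps ->
    exists q : T -> rat, v i (y - \sum_(t | tag t == i) q t *: at_ t) < eps.
  move=> eps0; have [_ _ /(_ y eps eps0)[q hq]] := hac i.
  exists (@untag 'I_r J rat 0 i q); rewrite sumE; apply: le_lt_trans hq.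
  by rewrite le_eqVlt; apply/orP; left; apply/eqP; congr (v i (_ - _));
     apply: eq_bigr => l _; rewrite (untagE _ _ (erefl : tag (Tagged J l) = i)).
have := fnorm_le_prod hv0 hpi hv iv sv c10 indep dense x0.
have -> : \prod_(t : T) v (tag t) x = \prod_i v i x ^+ local_degree (v i).
  rewrite -(@sig_big_dep R 1 *%R 'I_r J predT (fun _ => predT) (fun i' l => v i' x)).
  by apply: eq_bigr => i _; rewrite prodr_const card_ord.
rewrite -ler_ln ?posrE; last 2 first.
- exact: (av_gt0 hv0 (fnorm_neq0 x0)).
- by apply: prodr_gt0 => i _; rewrite exprn_gt0 // (av_gt0 (ext_abs (hv i))).
move/le_trans; apply; rewrite ln_prodX; last first.
  by move=> i; exact: (av_gt0 (ext_abs (hv i))).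
by rewrite (big_nth (fun=> 0)) big_mkord.
Qed.
End LocalDegree.

(** * The rational product formula *)

Section Padic.
Variables (R : realType) (p : nat).
Hypothesis pp : prime p.
Let P : R := p%:R.
Notation padic := (padic_abs R p).

Let P1 : 1 < P. Proof. by rewrite ltr1n prime_gt1. Qed.
Let P0 : 0 < P. Proof. exact: lt_trans P1. Qed.
Let PX0 m : P ^+ m != 0. Proof. by rewrite expf_neq0 // gt_eqF. Qed.

Lemma padic0 : padic 0 = 0. Proof. by rewrite /padic_abs eqxx. Qed.

Lemma padicE q : q != 0 ->
  padic q = P ^+ logn p `|denq q| / P ^+ logn p `|numq q|.
Proof.
move=> q0; rewrite /padic_abs (negPf q0) expfzDr ?gt_eqF // -exprnP.
by rewrite -exprz_inv -exprnP exprVn.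
Qed.

Lemma padic_frac (a b : int) : a != 0 -> b != 0 ->
  padic (a%:~R / b%:~R) = P ^+ logn p `|b| / P ^+ logn p `|a|.
Proof.
move=> a0 b0; set q := _ / _.
have q0 : q != 0 by rewrite mulf_neq0 ?invr_eq0 ?intr_eq0.
have e : (numq q * b = a * denq q)%R.
  apply: (@intr_inj rat); rewrite !intrM numqE.
  by move: (denq q)%:~R => D; rewrite /q mulrAC divfK ?intr_eq0.
have n0 : numq q != 0 by rewrite numq_eq0.
have e' : (`|numq q| * `|b| = `|a| * `|denq q|)%N by rewrite -!abszM e.
have := congr1 (logn p) e'.
rewrite !lognM ?absz_gt0 ?denq_neq0 // => h.
rewrite padicE //; apply/eqP; rewrite eqr_div // -!exprD.
by rewrite addnC -h addnC.
Qed.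

Lemma padic_gt0 q : q != 0 -> 0 < padic q.
Proof. by move=> q0; rewrite padicE // divr_gt0 ?exprn_gt0. Qed.

Lemma padic_ge0 q : 0 <= padic q.
Proof. by have [->|/padic_gt0/ltW//] := eqVneq q 0; rewrite padic0. Qed.

Lemma padicM x y : padic (x * y) = padic x * padic y.
Proof.
have [->|x0] := eqVneq x 0; first by rewrite mul0r padic0 mul0r.
have [->|y0] := eqVneq y 0; first by rewrite mulr0 padic0 mulr0.
have -> : x * y = (numq x * numq y)%:~R / (denq x * denq y)%:~R.
  by rewrite !intrM -mulf_div !divq_num_den.
rewrite padic_frac ?mulf_neq0 ?numq_eq0 ?denq_neq0 // !abszM.
rewrite !lognM ?absz_gt0 ?numq_eq0 ?denq_neq0 // !exprD -mulf_div.
by rewrite !padicE.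
Qed.

Lemma padicD_max x y : padic (x + y) <= Num.max (padic x) (padic y).
Proof.
have [->|x0] := eqVneq x 0; first by rewrite add0r le_max lexx orbT.
have [->|y0] := eqVneq y 0; first by rewrite addr0 le_max lexx.
have [->|xy0] := eqVneq (x + y) 0; first by rewrite padic0 le_max padic_ge0.
pose b := denq x * denq y; pose ax := numq x * denq y; pose ay := numq y * denq x.
have b0 : b != 0 by rewrite mulf_neq0 ?denq_neq0.
have dx : (denq x)%:~R != 0 :> rat by rewrite intr_eq0 denq_neq0.
have dy : (denq y)%:~R != 0 :> rat by rewrite intr_eq0 denq_neq0.
have ex : x = ax%:~R / b%:~R.
  by rewrite !intrM -mulf_div divff // mulr1 divq_num_den.
have ey : y = ay%:~R / b%:~R.
  by rewrite !intrM [(denq x)%:~R * _]mulrC -mulf_div divff // mulr1 divq_num_den.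
have exy : x + y = (ax + ay)%:~R / b%:~R by rewrite intrD mulrDl -ex -ey.
have ax0 : ax != 0 by rewrite mulf_neq0 ?numq_eq0 ?denq_neq0.
have ay0 : ay != 0 by rewrite mulf_neq0 ?numq_eq0 ?denq_neq0.
have axy0 : ax + ay != 0.
  by apply: contraNneq xy0 => h; rewrite exy h mul0r.
rewrite exy [in padic x]ex [in padic y]ey !padic_frac //.
have key : (minn (logn p `|ax|) (logn p `|ay|) <= logn p `|(ax + ay)%R|)%N.
  rewrite -pfactor_dvdn ?absz_gt0 //.
  set m := minn _ _.
  have h1 : (p ^ m %| `|ax|)%N by rewrite pfactor_dvdn ?absz_gt0 // geq_minl.
  have h2 : (p ^ m %| `|ay|)%N by rewrite pfactor_dvdn ?absz_gt0 // geq_minr.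
  move: (p ^ m)%N h1 h2 => d h1 h2.
  have : (d%:Z %| ax + ay)%Z by apply: rpredD; rewrite dvdzE absz_nat.
  by rewrite dvdzE absz_nat.
have mono i j : (i <= j)%N -> P ^+ logn p `|b| / P ^+ j <= P ^+ logn p `|b| / P ^+ i.
  move=> ij; rewrite ler_pM2l ?exprn_gt0 // lef_pV2 ?posrE ?exprn_gt0 //.
  by rewrite ler_weXn2l // ltW.
rewrite le_max; move: key; rewrite geq_min => /orP[h|h]; first by rewrite mono.
by rewrite [X in _ || X]mono // orbT.
Qed.

Lemma padic_abs_value : abs_value padic.
Proof.
split; [exact: padic0|exact: padic_gt0|exact: padicM|move=> x y].
rewrite (le_trans (padicD_max x y)) // ge_max lerDl lerDr !padic_ge0 //.
Qed.

Lemma padic_le1 q : (`|denq q| < p)%N -> padic q <= 1.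
Proof.
move=> dp; have [->|q0] := eqVneq q 0; first by rewrite padic0 ler01.
rewrite padicE // ltn_log0 // expr0 mul1r invf_le1 ?exprn_gt0 //.
by rewrite exprn_ege1 // ltW.
Qed.

Lemma padic_prime (l : nat) : prime l -> padic l%:R = if l == p then P^-1 else 1.
Proof.
move=> pl; have -> : l%:R = (l%:Z)%:~R / 1%:~R :> rat by rewrite divr1.
rewrite padic_frac ?eqz_nat ?pnatr_eq0 //; last by rewrite -lt0n prime_gt0.
rewrite !absz_nat logn1 expr0 logn_prime // eq_sym.
by case: eqP => _; rewrite ?expr1 ?expr0 ?invr1 mul1r.
Qed.
End Padic.

Lemma norm_ratr_abs_value (R : realType) : abs_value (fun q : rat => `|ratr q : R|).
Proof.
split=> [|x x0|x y|x y].
- by rewrite rmorph0 normr0.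
- by rewrite normr_gt0 fmorph_eq0.
- by rewrite rmorphM normrM.
- by rewrite rmorphD ler_normD.
Qed.

Lemma ln_nat_primes (R : realType) (m N : nat) : (0 < m)%N -> (m <= N)%N ->
  ln (m%:R : R) = \sum_(p < N.+1 | prime p) (logn p m)%:R * ln p%:R.
Proof.
move=> m0 mN; rewrite -{1}(partnT m0) (widen_partn _ mN) big_mkord.
rewrite natr_prod big_mkcond [RHS]big_mkcond /=.
suff [_ ->] : 0 < \prod_(i < N.+1) ((i ^ logn i m)%:R : R) /\
  ln (\prod_(i < N.+1) ((i ^ logn i m)%:R : R)) =
  \sum_(i < N.+1) (if prime i then (logn i m)%:R * ln i%:R else 0) by [].
elim/big_rec2: _ => [|i y1 y2 _ [h1 h2]]; first by rewrite ln1.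
have [ip|ip] := boolP (prime i); last first.
  by rewrite lognE (negPf ip) /= expn0 mul1r -h2 add0r.
have i0 : 0 < (i%:R : R) by rewrite ltr0n prime_gt0.
rewrite natrX; split; first by rewrite mulr_gt0 // exprn_gt0.
by rewrite lnM ?posrE ?exprn_gt0 // lnXn // h2 mulr_natl.
Qed.

(** Primes beyond [N] divide neither numerator nor denominator, so the finite sum is the whole one;
    factoring both integers makes the terms cancel prime by prime. *)
Lemma rat_product_formula (R : realType) (q : rat) (N : nat) : q != 0 ->
  (`|numq q| <= N)%N -> (`|denq q| <= N)%N ->
  ln `|ratr q : R| + \sum_(p < N.+1 | prime p) ln (padic_abs R p q) = 0.
Proof.
move=> q0 hn hd; have n0 : (0 < `|numq q|)%N by rewrite absz_gt0 numq_eq0.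
have d0 : (0 < `|denq q|)%N by rewrite absz_gt0 denq_neq0.
have -> : `|ratr q : R| = `|numq q|%:R / `|denq q|%:R.
  by rewrite /ratr normrM normfV -!intr_norm !pmulrn !abszE.
rewrite ln_div ?posrE ?ltr0n // (ln_nat_primes R n0 hn) (ln_nat_primes R d0 hd).
rewrite -sumrB -big_split big1 //= => p pp.
have P0 : 0 < (p%:R : R) by rewrite ltr0n prime_gt0.
rewrite padicE // ln_div ?posrE ?exprn_gt0 // !lnXn // !mulr_natl.
by rewrite addrA subrK subrr.
Qed.

(** * Heights *)

Section Global.
Variables (R : realType) (k : fieldExtType rat).
Notation n := (\dim {:k}).
Implicit Types x y z : k.

Definition ext_inf : set (k -> R) := ext_av (fun q : rat => `|ratr q : R|).
Definition ext_p (p : nat) : set (k -> R) := ext_av (padic_abs R p).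

(** Finite truncations of [places]; the recursion lets a sum over places be split prime by prime. *)
Fixpoint places_upto (N : nat) : set (k -> R) :=
  if N is M.+1 then
    (places_upto M `|` (if prime N then ext_p N else set0))%classic
  else ext_inf.

(** The element [pi] of the local theory is 2 at the archimedean absolute value and 1/p at the
    p-adic one. *)
Let two_gt1 : 1 < `|ratr 2%:R : R|.
Proof. by rewrite ratr_nat normr_nat ltr1n. Qed.

Let padic_inv_gt1 p : prime p -> 1 < padic_abs R p (p%:R)^-1.
Proof.
move=> pp; rewrite (avV (padic_abs_value R pp)) padic_prime // eqxx invrK.
by rewrite ltr1n prime_gt1.
Qed.

Lemma ext_inf_finite : finite_set ext_inf.
Proof. exact: (ext_finite k (norm_ratr_abs_value R) two_gt1). Qed.

Lemma ext_p_finite p : prime p -> finite_set (ext_p p).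
Proof.
by move=> pp; exact: (ext_finite k (padic_abs_value R pp) (padic_inv_gt1 pp)).
Qed.

Lemma places_upto_finite N : finite_set (places_upto N).
Proof.
elim: N => [|N IH]; first exact: ext_inf_finite.
rewrite /= finite_setU; split => //.
by case: ifP => [/ext_p_finite//|_]; exact: finite_set0.
Qed.

Lemma places_upto_sub N : (places_upto N `<=` @places R k)%classic.
Proof.
elim: N => [|N IH] v /=; first by case=> h1 h2; split => //; left.
case=> [/IH//|]; case: ifP => // pN [h1 h2]; split => //; right.
by exists N.+1.
Qed.

Lemma places_uptoP N v : places v -> places_upto N v \/
  exists p, [/\ prime p, (N < p)%N & ext_p p v].
Proof.
case=> h1 [h2|[p [pp h2]]].
  by left; elim: N => [|N IH]; [split|left].
have [pN|Np] := leqP p N; last by right; exists p.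
left; elim: N pN => [|N IH] pN; first by move: pN; rewrite leqn0 => /eqP e; rewrite e in pp.
have [e|pN'] := eqVneq p N.+1; first by right; rewrite -e pp.
by left; apply: IH; rewrite -ltnS ltn_neqAle pN' pN.
Qed.

(** Makes the unions in [places_upto] disjoint: above a new prime p the value of p is 1/p, hence
    below 1. *)
Lemma places_upto_prime_ge1 N v (p : nat) : prime p -> (N < p)%N ->
  places_upto N v -> 1 <= v (ratr p%:R).
Proof.
move=> pp; elim: N => [|N IH] Np /=.
  by case=> _ ->; rewrite ratr_nat normr_nat ler1n prime_gt0.
case=> [h|]; first by apply: IH => //; exact: ltnW.
case: ifP => // pN [_ ->]; rewrite padic_prime //.
by case: eqP => // e; rewrite e ltnn in Np.
Qed.

Lemma places_upto_sum N (F : (k -> R) -> R) :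
  \sum_(v \in places_upto N) F v =
  \sum_(v \in ext_inf) F v + \sum_(p < N.+1 | prime p) \sum_(v \in ext_p p) F v.
Proof.
pose G p := \sum_(v \in ext_p p) F v.
have G1 : \sum_(p < 1 | prime p) G p = 0 by rewrite big1 // => -[[]].
have GS M : \sum_(p < M.+2 | prime p) G p =
    \sum_(p < M.+1 | prime p) G p + (if prime M.+1 then G M.+1 else 0).
  by rewrite big_mkcond big_ord_recr /= -big_mkcond.
elim: N => [|N IH]; first by rewrite G1 addr0.
rewrite GS addrA -IH /=.
case: ifP => pN; last by rewrite setU0 addr0.
apply: fsbigU0; [exact: places_upto_finite|exact: ext_p_finite|].
move=> v [h1 [_ h2]]; have := places_upto_prime_ge1 pN (ltnSn N) h1.
rewrite h2 padic_prime // eqxx leNgt invf_lt1 ?ltr0n ?ltr1n ?prime_gt1 //.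
Qed.

Lemma places_upto_sum_ge0 x N : x != 0 ->
  (`|numq (fnorm x)| <= N)%N -> (`|denq (fnorm x)| <= N)%N ->
  0 <= \sum_(v \in places_upto N) (local_degree v)%:R * ln (v x).
Proof.
move=> x0 hn hd.
rewrite places_upto_sum -[leLHS](rat_product_formula R (fnorm_neq0 x0) hn hd).
apply: lerD; first exact: (ext_sum_ge (norm_ratr_abs_value R) two_gt1 x0).
apply: ler_sum => p pp.
exact: (ext_sum_ge (padic_abs_value R pp) (padic_inv_gt1 pp) x0).
Qed.

(* For large [p] the powers of [y] have [p]-integral coordinates, hence are
   [v]-bounded for [v] above [p]. *)
Lemma ext_p_le1 y : exists N, forall p v, prime p -> (N < p)%N -> ext_p p v -> v y <= 1.
Proof.
(* A prime above this sum of denominators divides none of them. *)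
pose N := (\sum_(i < n) \sum_(j < n) `|denq (mulmat y i j)|)%N; exists N => p v pp Np hv.
have va := ext_abs hv; have pa := padic_abs_value R pp.
have int0 i j : padic_abs R p (mulmat y i j) <= 1.
  apply: padic_le1 => //; apply: leq_ltn_trans Np.
  by rewrite /N (bigD1 i) //= (bigD1 j) //= -addnA leq_addr.
have intm m i j : padic_abs R p (mulmat (y ^+ m) i j) <= 1.
  elim: m i j => [|m IH] i j.
    rewrite expr0 mulmat1 mxE; case: (i == j); rewrite ?mulr1n ?mulr0n.
      by rewrite (av1 pa).
    by rewrite (av0 pa) ler01.
  rewrite exprS mulmatM mxE; elim/big_ind: _ => [|a b ha hb|l _].
  - by rewrite (av0 pa) ler01.
  - by rewrite (le_trans (padicD_max R pp _ _)) // ge_max ha hb.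
  - by rewrite (avM pa) mulr_ile1 // (av_ge0 pa).
have n0 : (0 < n)%N by exact: (adim_gt0 {:k}%AS).
pose i0 := Ordinal n0.
have vb := av_gt0 va (bas_neq0 i0).
apply: (@expr_dominated _ _ _ ((\sum_(j < n) v (bas j)) / v (bas i0))) => //.
  exact: (av_ge0 va).
move=> m; rewrite expr1n mulr1 ler_pdivlMr // -(avX va) -(avM va).
rewrite [y ^+ m * _]crd_sum (le_trans (av_sum va _ _ _)) // ler_sum // => j _.
rewrite (ext_Z _ _ hv) ger_pMl; last exact: (av_gt0 va (bas_neq0 j)).
by have := intm m i0 j; rewrite mxE.
Qed.

Lemma ext_p_eq1 y : y != 0 ->
  exists N, forall p v, prime p -> (N < p)%N -> ext_p p v -> v y = 1.
Proof.
move=> y0; have [N1 h1] := ext_p_le1 y; have [N2 h2] := ext_p_le1 y^-1.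
exists (maxn N1 N2) => p v pp; rewrite gtn_max => /andP[p1 p2] hv.
have va := ext_abs hv; have vy := av_gt0 va y0.
apply/eqP; rewrite eq_le (h1 p) //=.
by have := h2 p v pp p2 hv; rewrite (avV va) invf_le1.
Qed.

Lemma ext_p_eq1_seq (s : seq k) :
  exists N, forall p v, prime p -> (N < p)%N -> ext_p p v ->
    forall y, y \in s -> y != 0 -> v y = 1.
Proof.
elim: s => [|y s [N hN]]; first by exists 0%N.
have [M hM] : exists M, forall p v, prime p -> (M < p)%N -> ext_p p v ->
    y != 0 -> v y = 1.
  have [->|y0] := eqVneq y 0; first by exists 0%N.
  by have [M hM] := ext_p_eq1 y0; exists M => p v *; apply: (hM p).
exists (maxn N M) => p v pp; rewrite gtn_max => /andP[p1 p2] hv z.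
rewrite inE => /predU1P[->|zs] z0; first exact: (hM p).
exact: (hN p).
Qed.

Definition max_abs (s : seq k) (v : k -> R) : R := \big[Num.max/0]_(y <- s) v y.

Lemma max_abs_ge0 s v : 0 <= max_abs s v.
Proof. exact: bigmax_ge_id. Qed.

Lemma le_max_abs s v y : y \in s -> v y <= max_abs s v.
Proof. by move=> ys; apply: (le_bigmax_seq 0 y xpredT) => //. Qed.

Lemma max_abs_le s v M : 0 <= M -> (forall y, y \in s -> v y <= M) -> max_abs s v <= M.
Proof.
move=> M0 h; rewrite /max_abs big_seq; elim/big_ind: _ => // a b ha hb.
by rewrite ge_max ha hb.
Qed.

(** Above large primes every nonzero entry has value 1. The nonzero [y] ensures that the maximum is
    then 1 and not the default 0, so its logarithm vanishes. *)
Lemma height_places_upto (s : seq k) y : y \in s -> y != 0 ->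
  exists N0, forall N, (N0 <= N)%N ->
  height R s = n%:R^-1 * \sum_(v \in places_upto N) (local_degree v)%:R * ln (max_abs s v).
Proof.
move=> ys y0; have [N0 hN0] := ext_p_eq1_seq s; exists N0 => N NN.
rewrite /height; congr (_ * _); apply/esym; apply: fsbig_widen.
  exact: places_upto_sub.
move=> v [hp hn]; case: (places_uptoP N hp) => [//|[p [pp Np hv]]].
have va := ext_abs hv.
have h z : z \in s -> z != 0 -> v z = 1.
  by move=> zs z0; apply: (hN0 p) => //; exact: leq_ltn_trans Np.
rewrite /preimage /=; suff -> : max_abs s v = 1 by rewrite ln1 mulr0.
apply/eqP; rewrite eq_le -{2}(h y ys y0) le_max_abs // andbT.
apply: max_abs_le => // z zs; have [->|z0] := eqVneq z 0; first by rewrite (av0 va) ler01.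
by rewrite h.
Qed.

(** At each place the maximum over [t] is at least [v x] times the maximum over [s]; the
    contributions of [x] have nonnegative sum by the norm inequality. A common [N] truncates both
    heights and bounds the numerator and denominator of the norm of [x]. *)
Lemma height_le_scaled (s t : seq k) x : x != 0 -> 1 \in s ->
  (forall y, y \in s -> exists (z : k) (b : bool), z \in t /\ z = (-1) ^+ b * (x * y)) ->
  height R s <= height R t.
Proof.
move=> x0 s1 hst; have [z [b [zt ez]]] := hst 1 s1.
have z0 : z != 0 by rewrite ez mulr1 mulf_neq0 // signr_eq0.
have [N1 h1] := height_places_upto s1 (oner_neq0 k).
have [N2 h2] := height_places_upto zt z0.
pose N := (N1 + N2 + `|numq (fnorm x)| + `|denq (fnorm x)|)%N.
rewrite (h1 N) ?(h2 N) //; [|by rewrite /N; lia|by rewrite /N; lia].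
rewrite ler_wpM2l ?invr_ge0 ?ler0n //.
have := @places_upto_sum_ge0 x N x0; rewrite /N.
have [l el] := (finite_seqP _).1 (places_upto_finite N).
pose l' := undup l; have ul : uniq l' by exact: undup_uniq.
have el' : places_upto N = [set` l']%classic.
  by rewrite el; apply/seteqP; split => w; rewrite /= mem_undup.
rewrite -/N el' -!fsbig_seq // => h.
have {}h : 0 <= \sum_(v <- l') (local_degree v)%:R * ln (v x).
  by apply: h; rewrite /N; lia.
rewrite -[leLHS]addr0; apply: (le_trans (lerD (lexx _) h)).
rewrite -big_split /= big_seq [leRHS]big_seq; apply: ler_sum => v vl.
have [va _] : places v by apply: (@places_upto_sub N); rewrite el'.
rewrite -mulrDr ler_wpM2l ?ler0n //.
have ms : 0 < max_abs s v.
  by apply: lt_le_trans (le_max_abs v s1); rewrite (av1 va).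
have vx : 0 < v x by exact: (av_gt0 va).
rewrite addrC -lnM ?posrE // ler_ln ?posrE ?mulr_gt0 //; last first.
  by apply: lt_le_trans (le_max_abs v zt); exact: (av_gt0 va).
rewrite mulrC -ler_pdivlMr //; apply: max_abs_le => [|y ys].
  by rewrite divr_ge0 ?max_abs_ge0 // ltW.
rewrite ler_pdivlMr // mulrC -(avM va).
have [z' [b' [z't ez']]] := hst y ys.
by rewrite -(av_sign va b') -ez' le_max_abs.
Qed.
End Global.

Unset Implicit Arguments.

Theorem theorem5p1 (R : realType) (k : fieldExtType rat) (g : nat)
  (f : {poly k}) :
  (0 < g)%N -> f \is monic -> size f = (2 * g + 2)%N ->
  discriminant f != 0 ->
  forall U V Rp : {poly k}, mumford_triple g f U V Rp ->
  forall w : spinor_t k g, pure_spinor f (Psi_gens g U V Rp) w ->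
  height R (rev U) <= height R [seq w J | J <- enum [set: {set 'I_g}]].
Proof.
move=> g0 mf sf _ U V Rp hM w hw.
have [mU _ mg _ _] := hM.
have x0 := spinor_low_neq0 mf sf hM hw.
have := @height_le_scaled R k (rev U) [seq w J | J <- enum (finset.setTfor {set 'I_g})] _ x0.
apply=> [|y].
  (* The leading coefficient of [U] provides the entry 1. *)
  rewrite mem_rev -(monicP mU); apply: mem_nth.
  by rewrite prednK // size_poly_gt0 monic_neq0.
rewrite mem_rev => /(nthP 0)[i iU <-].
have im : (i <= (size U).-1)%N by rewrite -ltnS prednK // (leq_ltn_trans _ iU).
have [J [b eJ]] := spinor_coef mf sf hM hw im.
exists (w J), b; split => //; apply: map_f.
by rewrite mem_enum finset.in_setT.
Qed.
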